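(* Suppose that $p=k/l$, where $k,l$ are integers such that $1\le l<k$, and that $r$ is a real number with $-1<r\le p-1$. Then there exists a unique probability measure $\nu(p,r)$ such that $\left\{\binom{mp+r}{m}\right\}_{m=0}^\infty$ is its moment sequence. Moreover, $\nu(p,r)$ can be represented as the Mellin convolution \[ \nu(p,r)=\mathbf{b}(\widetilde{\alpha}_1,\beta_1,l)\circ\cdots\circ\mathbf{b}(\widetilde{\alpha}_k,\beta_k,l)\circ\delta_{c(p)}, \] where $c(p):=p^p(p-1)^{1-p}$. In particular, $\nu(p,r)$ is absolutely continuous and its support is $[0,c(p)]$.
   Context: For $a\in\mathbb{R}$ and $n\in\{0,1,2,\ldots\}$, $\binom{a}{n}:=a(a-1)\cdots(a-n+1)/n!$ (with $\binom a0=1$). Mellin convolution: for probability measures $\mu_1,\mu_2$ on $[0,\infty)$, $(\mu_1\circ\mu_2)(A):=\int_0^\infty\int_0^\infty \mathbf{1}_A(xy)\,d\mu_1(x)\,d\mu_2(y)$ for Borel $A\subseteq[0,\infty)$, i.e. the distribution of the product of independent nonnegative random variables with distributions $\mu_1,\mu_2$. $\delta_c$ denotes the unit point mass at $c$. Modified beta distributions: for $u,v,l>0$, $\mathbf{b}(u+v,u,l)$ is the probability measure on $[0,1]$ with density $\frac{l}{\mathrm{B}(u,v)}x^{lu-1}(1-x^l)^{v-1}$, where $\mathrm{B}$ is the Euler beta function; and $\mathbf{b}(u,u,l):=\delta_1$ for $u,l>0$. Parameters: $\beta_j:=\frac{r+j}{k}$ for $1\le j\le k$. Put $j_i':=\left\lfloor\frac{ik}{l}-r\right\rfloor$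 for $1\le i\le l$, $j_0':=0$, $j_{l+1}':=k+1$; then $0=j_0'<j_1'<\cdots<j_l'\le k<k+1=j_{l+1}'$. For $1\le j\le k$, \[ \widetilde{\alpha}_j:=\begin{cases}\dfrac{i}{l}&\text{if } j=j_i',\ 1\le i\le l,\\[2mm] \dfrac{r+j-i}{k-l}&\text{if } j_i'<j<j_{i+1}',\ 0\le i\le l.\end{cases} \] With these definitions $\beta_j\le\widetilde\alpha_j$ for all $1\le j\le k$, so the measures $\mathbf{b}(\widetilde{\alpha}_j,\beta_j,l)$ are defined. *)

(* Defs.v *)
From HB Require Import structures.
From mathcomp Require Import all_boot all_order all_algebra.
From mathcomp Require Import all_classical all_reals all_analysis.

Set Implicit Arguments.
Unset Strict Implicit.
Unset Printing Implicit Defensive.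

Import Order.TTheory GRing.Theory Num.Theory.
Import numFieldNormedType.Exports.

Local Open Scope classical_set_scope.
Local Open Scope ring_scope.

Definition gbinom (R : realType) (a : R) (n : nat) : R :=
  (\prod_(i < n) (a - i%:R)) / n`!%:R.

Definition has_moments (R : realType) (mu : probability (measurableTypeR R) R)
    (s : nat -> R) : Prop :=
  forall m : nat,
    mu.-integrable [set: R] (fun x : R => (x ^+ m)%:E) /\
    (\int[mu]_x (x ^+ m)%:E)%E = (s m)%:E.

Definition msupport (R : realType) (mu : set (measurableTypeR R) -> \bar R) :
    set R :=
  [set x | forall U : set R, open U -> U x -> (0 < mu U)%E].

(* Measures on [0, +oo[ and on [0, 1] are seen as Borel measures on R. *)
Definition mellin_conv (R : realType)
    (mu1 mu2 : set (measurableTypeR R) -> \bar R)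
    (A : set (measurableTypeR R)) : \bar R :=
  (\int[mu2]_(y in `[0%R, +oo[)
     \int[mu1]_(x in `[0%R, +oo[) (\1_A (x * y)%R)%:E)%E.

(* The library's beta_fun only takes natural number arguments. *)
Definition euler_beta (R : realType) (u v : R) : R :=
  \int[lebesgue_measure]_(t in `[0, 1]) (t `^ (u - 1) * (1 - t) `^ (v - 1)).

(* b(a, u, l), meaningful for 0 < u <= a and 0 < l; v is a - u. *)
Definition mbeta (R : realType) (a u l : R) :
    set (measurableTypeR R) -> \bar R :=
  if a == u then \d_(1 : R)
  else fun A =>
    (\int[lebesgue_measure]_(x in A `&` `[0%R, 1%R])
      (l / euler_beta u (a - u)
        * x `^ (l * u - 1) * (1 - x `^ l) `^ (a - u - 1))%:E)%E.

Section parameters.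
Context (R : realType).
Variables (k l : nat) (r : R).

Definition beta_ (j : nat) : R := (r + j%:R) / k%:R.

Definition jprime (i : nat) : int :=
  if i == 0%N then 0
  else if i == l.+1 then k.+1%:Z
  else Num.floor (i%:R * k%:R / l%:R - r).

(* For 1 <= l < k, -1 < r <= k / l - 1 and 1 <= j <= k, exactly one of the two
   picks succeeds, with a unique i, so the final 0 is never reached. *)
Definition talpha (j : nat) : R :=
  if [pick i : 'I_l.+1 | (0 < i)%N && (j%:Z == jprime i)] is Some i
  then i%:R / l%:R
  else if [pick i : 'I_l.+1 | jprime i < j%:Z < jprime i.+1] is Some i
  then (r + j%:R - i%:R) / (k%:R - l%:R)
  else 0.

Definition mellin_beta (c : R) : set (measurableTypeR R) -> \bar R :=
  foldr (@mellin_conv R) (\d_(c : R))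
    [seq mbeta (talpha j) (beta_ j) l%:R | j <- iota 1 k].

End parameters.

Definition cp (R : realType) (p : R) : R := p `^ p * (p - 1) `^ (1 - p).

(* Main.v *)
Require Import Defs.
From HB Require Import structures.
From mathcomp Require Import all_boot all_order all_algebra.
From mathcomp Require Import all_classical all_reals all_analysis.

From mathcomp Require Import measurable_realfun ring lra zify.

Set Implicit Arguments.
Unset Strict Implicit.
Unset Printing Implicit Defensive.

Import Order.TTheory GRing.Theory Num.Theory.
Import numFieldNormedType.Exports.

Local Open Scope classical_set_scope.
Local Open Scope ring_scope.

(* The m-th moment of b(u + v, u, l) is B(u + m/l, v) / B(u, v).  The functional
   equation B(u, v) = (u + v) / u * B(u + 1, v) and the monotonicity of B in u give
     B(u + s, v) / B(u, v)
       = lim_n \prod_(i < n) ((u + v + s + i) (u + i)) / ((u + s + i) (u + v + i)),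
   so that the Gamma function is not needed: in the n-truncated product over j of
   these ratios, the multiplication formula of Gauss is a regrouping of factors, and
   what remains after cancellation is gbinom (m p + r) m times an elementary quotient
   tending to c(p)^-m.  For the grouping, the alpha~_j are the i / l (1 <= i <= l)
   together with the (r + t) / (k - l) (1 <= t <= k - l).
   Uniqueness: a law with these moments is carried by a compact interval, on which
   the polynomials (1 - h^n)^(n 2^n), with h affine and valued in [0, 1], converge
   pointwise to the indicator of h < 1/2; their integrals determine the measure of
   every ray.
   Absolute continuity and support: since l < k some factor of the convolution is a
   genuine beta law, with a positive density on ]0, 1[, and convolving with the other
   factors, which have no atom at 0, preserves both properties. *)

(** * Integration over the open unit interval *)

Section unit_interval.
Context (R : realType).
Local Notation leb := (@lebesgue_measure R).

(** Monotone convergence along increasing sets. This reduces integrands singular at 0 or 1 to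
    compact subintervals, where calculus applies. *)
Lemma cvg_integral_itv01 (f : R -> R) (a b : R ^nat) :
  measurable_fun setT f -> (forall x, 0 <= f x) ->
  nonincreasing_seq a -> nondecreasing_seq b ->
  (forall n, 0 < a n) -> (forall n, b n < 1) ->
  a @ \oo --> (0 : R) -> b @ \oo --> (1 : R) ->
  (\int[leb]_(x in `[a n, b n]) (f x)%:E @[n --> \oo] -->
   \int[leb]_(x in `]0%R, 1%R[) (f x)%:E)%E.
Proof.
move=> mf f0 da ib a0 b1 ca cb.
have -> : `]0%R, 1%R[%classic = \bigcup_n `[a n, b n]%classic :> set R.
  apply/seteqP; split => [x /=|x [n _] /=]; rewrite !in_itv /= => /andP[x0 x1].
    near \oo => n; exists n => //=; rewrite in_itv /=; apply/andP; split.
      by apply/ltW; near: n; exact: (cvgr_lt (0 : R)).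
    by apply/ltW; near: n; exact: (cvgr_gt (1 : R)).
  by rewrite (lt_le_trans (a0 n)) //= (le_lt_trans _ (b1 n)).
apply: ge0_nondecreasing_set_cvg_integral => //.
- move=> m n mn; rewrite subsetEset; apply: subset_itvScc.
    by rewrite bnd_simp; exact: da.
  by rewrite bnd_simp; exact: ib.
- by move=> n; apply/measurable_EFinP; apply: measurable_funS mf.
- by move=> n x _; rewrite lee_fin.
Unshelve. all: by end_near. Qed.

Lemma in_itv01_nbhs (x : R) : x \in `]0, 1[ -> \forall y \near x, y \in `]0, 1[.
Proof. exact: near_in_itvoo. Qed.

Lemma FTC_itv01 (F f : R -> R) (a b : R) : 0 < a -> a < b -> b < 1 ->
  (forall x : R, x \in `]0, 1[ -> is_derive x 1 F (f x)) ->
  (forall x : R, x \in `]0, 1[ -> {for x, continuous f}) ->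
  (\int[leb]_(x in `[a, b]) (f x)%:E = (F b - F a)%:E)%E.
Proof.
move=> a0 ab b1 dF cf.
have sub (x : R) : x \in `[a, b] -> x \in `]0, 1[.
  by rewrite !in_itv /= => /andP[? ?]; apply/andP; split; lra.
have sub' (x : R) : x \in `]a, b[ -> x \in `]0, 1[.
  by rewrite !in_itv /= => /andP[? ?]; apply/andP; split; lra.
have cF (x : R) : x \in `]0, 1[ -> {for x, continuous F}.
  move=> xI; apply: differentiable_continuous; apply/derivable1_diffP.
  by have [] := dF _ xI.
rewrite EFinB; apply: continuous_FTC2 => //.
- by apply: continuous_in_subspaceT => x; rewrite inE => /sub; exact: cf.
- split.
  + by move=> x /sub' xI; have [] := dF _ xI.
  + by apply: cvg_at_right_filter; apply: cF; apply: sub; rewrite in_itv /= lexx ltW.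
  + by apply: cvg_at_left_filter; apply: cF; apply: sub; rewrite in_itv /= lexx ltW.
- by move=> x /sub' xI; rewrite derive1E; have [_ ->] := dF _ xI.
Qed.

Lemma substitution_itv01 (phi dphi G : R -> R) (a b : R) :
  0 < a -> a < b -> b < 1 ->
  (forall x : R, x \in `]0, 1[ -> phi x \in `]0, 1[) ->
  {in `]0, 1[ &, {homo phi : x y / x < y}} ->
  (forall x : R, x \in `]0, 1[ -> is_derive x 1 phi (dphi x)) ->
  (forall x : R, x \in `]0, 1[ -> {for x, continuous dphi}) ->
  (forall x : R, x \in `]0, 1[ -> {for x, continuous G}) ->
  (\int[leb]_(x in `[phi a, phi b]) (G x)%:E =
   \int[leb]_(x in `[a, b]) (G (phi x) * dphi x)%:E)%E.
Proof.
move=> a0 ab b1 im mono dF cf cG.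
have sub (x : R) : x \in `[a, b] -> x \in `]0, 1[.
  by rewrite !in_itv /= => /andP[? ?]; apply/andP; split; lra.
have sub' (x : R) : x \in `]a, b[ -> x \in `]0, 1[.
  by rewrite !in_itv /= => /andP[? ?]; apply/andP; split; lra.
have cF (x : R) : x \in `]0, 1[ -> {for x, continuous phi}.
  move=> xI; apply: differentiable_continuous; apply/derivable1_diffP.
  by have [] := dF _ xI.
have aI : a \in `]0, 1[ by apply: sub; rewrite in_itv /= lexx ltW.
have bI : b \in `]0, 1[ by apply: sub; rewrite in_itv /= lexx ltW.
have E (x : R) : x \in `]0, 1[ -> derive1 phi x = dphi x.
  by move=> xI; rewrite derive1E; have [_ ->] := dF _ xI.
(* [derive1 phi] coincides with [dphi] only on []0, 1[]; that interval being open, they agree near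
   [x] and continuity transfers. *)
have cd (x : R) : x \in `]0, 1[ -> {for x, continuous (derive1 phi)}.
  move=> xI; suff: derive1 phi y @[y --> x] --> derive1 phi x by [].
  rewrite (E _ xI).
  apply: cvg_trans (cf _ xI); apply: near_eq_cvg; near=> y.
  by rewrite E //; near: y; exact: in_itv01_nbhs.
rewrite (@integration_by_substitution_increasing _ phi) //; first last.
- apply: continuous_in_subspaceT => x; rewrite inE => xI; apply: cG.
  move: xI (im _ aI) (im _ bI); rewrite /= !in_itv /= => /andP[? ?] /andP[? ?] /andP[? ?].
  by apply/andP; split; lra.
- split.
  + by move=> x /sub' xI; have [] := dF _ xI.
  + by apply: cvg_at_right_filter; apply: cF.
  + by apply: cvg_at_left_filter; apply: cF.
- apply/cvg_ex; exists (derive1 phi b); apply: cvg_at_left_filter; exact: cd.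
- apply/cvg_ex; exists (derive1 phi a); apply: cvg_at_right_filter; exact: cd.
- by move=> x /sub'; exact: cd.
- by move=> x y xI yI; apply: mono; exact: sub.
- exact: ltW.
by apply: eq_integral => x; rewrite inE /= => /sub xI; rewrite -(E _ xI).
Unshelve. all: by end_near. Qed.

End unit_interval.

(** * Measure-theoretic preliminaries *)

Section measure_preliminaries.
Context d (T : measurableType d) (R : realType).
Local Open Scope ereal_scope.

Import HBNNSimple.

(** The integral is built from simple functions, whose level sets are measurable. [m1] and [m2] are
    bare set functions, so this applies to [mbeta] and to iterated [mellin_conv]. *)
Lemma eq_integral_measurable (m1 m2 : set T -> \bar R) (D : set T) (f : T -> \bar R) :
  (forall A, measurable A -> m1 A = m2 A) ->
  \int[m1]_(x in D) f x = \int[m2]_(x in D) f x.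
Proof.
move=> m12.
have S (h : {nnsfun T >-> R}) : sintegral m1 h = sintegral m2 h.
  by rewrite !sintegralET; apply: eq_fsbigr => x _; rewrite m12.
rewrite /integral; congr (ereal_sup _ - ereal_sup _); apply/seteqP;
  by split => _ [h hf <-]; exists h.
Qed.

(** Normalizing a measure of mass 1 leaves it unchanged, while [mnormalize] carries the probability
    structure. *)
Lemma mk_probability (m : {measure set T -> \bar R}) : m setT = 1 ->
  exists P : probability T R, P = m :> (set T -> \bar R).
Proof.
move=> m1; exists (mnormalize m (dirac point : probability T R)).
by apply/funext => A; rewrite /= /mnormalize m1 onee_eq0 /= invr1 mule1.
Qed.

(** A zero integral would force [f] to vanish almost everywhere, hence [D] to lie in a null set. *)
Lemma integral_gt0 (mu : {measure set T -> \bar R}) (D : set T) (f : T -> \bar R) :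
  measurable D -> measurable_fun setT f -> (forall x, 0 <= f x) ->
  (forall x, D x -> 0 < f x) -> 0 < mu D -> 0 < \int[mu]_x f x.
Proof.
move=> mD mf f0 fp muD; rewrite lt_neqAle integral_ge0 ?andbT //.
apply/eqP => I0.
have [|N [mN N0 sN]] := (ae_eq_integral_abs mu measurableT mf).1.
  by rewrite [RHS]I0; apply: eq_integral => x _; rewrite /= gee0_abs.
have : mu D <= mu N.
  rewrite le_measure ?inE // => x xD; apply: sN => /= /(_ I) /eqP.
  by rewrite gt_eqF // fp.
by rewrite N0 leNgt muD.
Qed.

Lemma integral_null (mu : {measure set T -> \bar R}) (N : set T) (f : T -> \bar R) :
  measurable N -> measurable_fun setT f -> (forall x, 0 <= f x) ->
  mu N = 0 -> (forall x, ~ N x -> f x = 0) -> \int[mu]_x f x = 0.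
Proof.
move=> mN mf f0 muN fN; rewrite (ge0_negligible_integral mN) //.
by rewrite setTD integral0_eq // => x; exact: fN.
Qed.

End measure_preliminaries.

(** * Measures with a density with respect to Lebesgue measure *)

Section density.
Context (R : realType) (f : measurableTypeR R -> R).
Local Notation T := (measurableTypeR R).
Local Notation leb := (@lebesgue_measure R).
Hypotheses (mf : measurable_fun [set: T] f) (f0 : forall x, 0 <= f x).

(* The two proofs are arguments so that the measure structure can be inferred. *)
Definition density_measure of measurable_fun [set: T] f & (forall x, 0 <= f x) :
    set T -> \bar R :=
  fun A => (\int[leb]_(x in A) (f x)%:E)%E.

Local Notation dm := (density_measure mf f0).
Local Open Scope ereal_scope.

Let dm0 : dm set0 = 0. Proof. by rewrite /density_measure integral_set0. Qed.

Let dm_ge0 A : 0 <= dm A.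
Proof. by apply: integral_ge0 => x _; rewrite lee_fin. Qed.

Let dm_sigma_additive : semi_sigma_additive dm.
Proof.
move=> /= F mF tF mUF; rewrite /density_measure; apply: cvg_toP.
  apply: ereal_nondecreasing_is_cvgn => m n mn.
  by apply: lee_sum_nneg_natr => // k _ _; apply: integral_ge0 => /= x _; rewrite lee_fin.
rewrite ge0_integral_bigcup//=.
- by apply/measurable_funTS/measurableT_comp.
- by move=> x _; rewrite lee_fin.
Qed.

HB.instance Definition _ := isMeasure.Build _ _ _ dm dm0 dm_ge0 dm_sigma_additive.

Lemma density_measureE A : dm A = \int[leb]_(x in A) (f x)%:E.
Proof. by []. Qed.

Import HBNNSimple.

Lemma ge0_integral_density (g : T -> \bar R) : measurable_fun [set: T] g ->
  (forall x, 0 <= g x) -> \int[dm]_x g x = \int[leb]_x (g x * (f x)%:E).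
Proof.
move=> mg g0.
have mfE : measurable_fun [set: T] (EFin \o f) by exact/measurable_EFinP.
pose h := nnsfun_approx measurableT mg.
have gE x : EFin \o h^~ x @ \oo --> g x by exact: cvg_nnsfun_approx.
have hnd x m n : (m <= n)%N -> ((h m x)%:E <= (h n x)%:E).
  by move=> mn; rewrite lee_fin; exact/lefP/nd_nnsfun_approx.
have H1 : \int[dm]_x (h n x)%:E @[n --> \oo] --> \int[dm]_x g x.
  have -> : \int[dm]_x g x = \int[dm]_x limn (fun n => (h n x)%:E).
    by apply: eq_integral => x _; apply/esym/cvg_lim => //; exact: gE.
  apply: cvg_monotone_convergence => //.
  - by move=> n; apply/measurable_EFinP; exact: measurable_funPT.
  - by move=> n x _; rewrite lee_fin.
  - by move=> x _ m n; exact: hnd.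
have H2 : \int[leb]_x ((h n x)%:E * (f x)%:E) @[n --> \oo] -->
    \int[leb]_x (g x * (f x)%:E).
  have -> : \int[leb]_x (g x * (f x)%:E) =
      \int[leb]_x limn (fun n => (h n x)%:E * (f x)%:E).
    apply: eq_integral => x _; apply/esym/cvg_lim => //.
    by apply: cvgeZr => //; exact: gE.
  apply: cvg_monotone_convergence => //.
  - by move=> n; apply: emeasurable_funM => //; apply/measurable_EFinP; exact: measurable_funPT.
  - by move=> n x _; rewrite mule_ge0 // lee_fin.
  - by move=> x _ m n mn; rewrite lee_wpmul2r ?lee_fin // -lee_fin hnd.
(* Both sides are limits along the same simple approximations [h n]; it remains to compare them for
   one simple function, decomposed over its finitely many values. *)
apply: cvg_unique H1 _ => //; apply: cvg_trans H2; apply: near_eq_cvg; near=> n.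
transitivity (\int[leb]_x (\sum_(y \in range (h n))
   (y%:E * ((\1_(h n @^-1` [set y]) x)%:E * (f x)%:E)))).
  apply: eq_integral => x _.
  rewrite [in LHS](fimfunE (h n) x) -fsumEFin // ge0_mule_fsuml.
    by apply: eq_fsbigr => y _; rewrite EFinM muleA.
  by move=> y; exact: nnfun_muleindic_ge0.
have mI y : measurable_fun [set: T]
    (fun x : T => (\1_(h n @^-1` [set y]) x)%:E * (f x)%:E).
  by apply: emeasurable_funM => //; exact/measurable_EFinP.
rewrite ge0_integral_fsum //; last 2 first.
- by move=> y; apply: measurable_funeM.
- move=> y x _; rewrite muleA; apply: mule_ge0; last by rewrite lee_fin.
  by rewrite -EFinM; exact: nnfun_muleindic_ge0.
rewrite integralT_nnsfun sintegralE; apply: eq_fsbigr => y.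
rewrite inE => -[x _ <-].
rewrite ge0_integralZl //; [|by move=> z _; rewrite mule_ge0 // lee_fin|by rewrite lee_fin].
congr (_ * _); rewrite [RHS]/= [RHS]density_measureE [RHS]integral_mkcond.
apply: eq_integral => z _; rewrite epatch_indic.
by rewrite muleC.
Unshelve. all: by end_near. Qed.

End density.

(** * The Euler beta function *)

Section euler_beta.
Context (R : realType).
Local Notation leb := (@lebesgue_measure R).
Implicit Types u v x t : R.

Lemma continuous_powR (p x : R) : 0 < x -> {for x, continuous (fun t => t `^ p)}.
Proof.
move=> x0; apply: differentiable_continuous; apply/derivable1_diffP.
by apply: derivable_powR; rewrite in_itv /= andbT.
Qed.

Lemma continuous_powR_onem (p x : R) : x < 1 ->
  {for x, continuous (fun t => (1 - t) `^ p)}.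
Proof.
move=> x1; apply: (@continuous_comp R R R (fun t => 1 - t) (fun t => t `^ p)).
  by apply: continuousB; [exact: cst_continuous|exact: cvg_id].
by apply: continuous_powR; rewrite subr_gt0.
Qed.

Definition betaf u v t := t `^ (u - 1) * (1 - t) `^ (v - 1).

Lemma betaf_ge0 u v t : 0 <= betaf u v t.
Proof. by rewrite mulr_ge0 ?powR_ge0. Qed.

Lemma measurable_powR_onem (p : R) :
  measurable_fun [set: R] (fun t : R => (1 - t) `^ p).
Proof.
apply: (@measurableT_comp _ _ _ _ _ _ (fun t : R => t `^ p)) => //.
exact: measurable_funB.
Qed.

Lemma measurable_betaf u v : measurable_fun [set: R] (betaf u v).
Proof. by apply: measurable_funM => //; exact: measurable_powR_onem. Qed.

Lemma continuous_betaf u v x : x \in `]0, 1[ -> {for x, continuous (betaf u v)}.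
Proof.
rewrite in_itv /= => /andP[x0 x1]; apply: continuousM.
  exact: continuous_powR.
exact: continuous_powR_onem.
Qed.

Lemma powR_subK (p x : R) : 0 < x -> x `^ p = x * x `^ (p - 1).
Proof.
move=> x0; rewrite -[X in X * _](powRr1 (ltW x0)) -powRD.
  by rewrite addrC subrK.
by rewrite (gt_eqF x0) implybT.
Qed.

(** This is 1 = (1 - x) + x multiplied by the integrand. *)
Lemma betaf_split u v x : x \in `]0, 1[ ->
  betaf u v x = betaf u (v + 1) x + betaf (u + 1) v x.
Proof.
rewrite in_itv /= => /andP[x0 x1]; rewrite /betaf !addrK.
rewrite (powR_subK v) ?subr_gt0 // (powR_subK u) //; ring.
Qed.

Lemma is_derive_betaf u v x : x \in `]0, 1[ ->
  is_derive x 1 (fun t => t `^ u * (1 - t) `^ v)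
    (u * betaf u (v + 1) x - v * betaf (u + 1) v x).
Proof.
rewrite in_itv /= => /andP[x0 x1].
have d1 : is_derive x 1 (fun t => t `^ u) (u * x `^ (u - 1)).
  exact: is_derive1_powR.
have d2 : is_derive x 1 (fun t => (1 - t) `^ v) (- (v * (1 - x) `^ (v - 1))).
  have d3 : is_derive (1 - x) 1 (fun t => t `^ v) (v * (1 - x) `^ (v - 1)).
    by apply: is_derive1_powR; rewrite subr_gt0.
  have d4 : is_derive x 1 (fun t : R => 1 - t) (-1).
    by rewrite -[X in is_derive _ _ _ X]add0r; apply: is_deriveB.
  have := @is_derive1_comp R (fun t => t `^ v) (fun t => 1 - t) x _ _ d3 d4.
  by rewrite mulrN1.
apply: is_derive_eq (is_deriveM d1 d2) _.
by rewrite /betaf !addrK /GRing.scale /=; ring.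
Qed.

(** The beta function with extended real values: its identities can be proved before its finiteness,
    and are then used to derive it. *)
Definition ebeta u v : \bar R := (\int[leb]_(t in `]0%R, 1%R[) (betaf u v t)%:E)%E.

Lemma ebeta_ge0 u v : (0 <= ebeta u v)%E.
Proof. by apply: integral_ge0 => t _; rewrite lee_fin betaf_ge0. Qed.

(** The offset 3 keeps every cut at most 1/3, so that [itv_cut n < 1 - itv_cut n] from the start. *)
Definition itv_cut n : R := n.+3%:R^-1.

Lemma itv_cut_gt0 n : 0 < itv_cut n. Proof. by rewrite invr_gt0. Qed.

Lemma itv_cut_le n : itv_cut n <= 3%:R^-1.
Proof. by rewrite lef_pV2 ?posrE// ler_nat. Qed.

Lemma itv_cut_lt n : itv_cut n < 1 - itv_cut n.
Proof. by have := itv_cut_le n; lra. Qed.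

Lemma itv_cut_nonincreasing : nonincreasing_seq itv_cut.
Proof. by move=> m n mn; rewrite lef_pV2 ?posrE// ler_nat. Qed.

Lemma itv_cut_cvg0 : itv_cut @ \oo --> (0 : R).
Proof.
have := @cvg_harmonic R; rewrite -(cvg_shiftn 2); apply: cvg_trans.
by apply: near_eq_cvg; near=> n; rewrite /itv_cut /= addn2.
Unshelve. all: by end_near. Qed.

Lemma onem_itv_cut_cvg1 : (fun n => 1 - itv_cut n) @ \oo --> (1 : R).
Proof. by rewrite -[X in _ --> X]subr0; apply: cvgB; [exact: cvg_cst|exact: itv_cut_cvg0]. Qed.

Lemma cvg_ebeta u v :
  (\int[leb]_(t in `[itv_cut n, (1 - itv_cut n)%R]) (betaf u v t)%:E @[n --> \oo] -->
    ebeta u v)%E.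
Proof.
apply: cvg_integral_itv01 => //.
- exact: measurable_betaf.
- exact: betaf_ge0.
- exact: itv_cut_nonincreasing.
- by move=> m n mn; rewrite lerD2l lerN2; exact: itv_cut_nonincreasing.
- exact: itv_cut_gt0.
- by move=> n; rewrite ltrBlDr ltrDl itv_cut_gt0.
- exact: itv_cut_cvg0.
- exact: onem_itv_cut_cvg1.
Qed.

Lemma cvg_itv_cut_powR (p : R) : 0 < p -> (fun n => itv_cut n `^ p) @ \oo --> (0 : R).
Proof.
move=> p0; have /cvg_at_rightP := powR_cvg0 p0; apply; split.
  exact: itv_cut_gt0.
exact: itv_cut_cvg0.
Qed.

Lemma cvg_onem_itv_cut_powR (p : R) : (fun n => (1 - itv_cut n) `^ p) @ \oo --> (1 : R).
Proof.
have E : 1 `^ p = 1 :> R by rewrite powR1.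
rewrite -[X in _ --> X]E.
apply: (cvg_comp (fun n => 1 - itv_cut n) (fun t => t `^ p) onem_itv_cut_cvg1).
exact: continuous_powR ltr01.
Qed.

Lemma cvg_itv_cut_boundary u v : 0 < u -> 0 < v ->
  (fun n => (1 - itv_cut n) `^ u * (1 - (1 - itv_cut n)) `^ v -
    itv_cut n `^ u * (1 - itv_cut n) `^ v)
   @ \oo --> (0 : R).
Proof.
move=> u0 v0; rewrite -[X in _ --> X](subrr (0 : R)).
under eq_fun do rewrite subKr.
apply: cvgB.
  by rewrite -[X in _ --> X](mul1r (0 : R)); apply: cvgM;
    [exact: cvg_onem_itv_cut_powR|exact: cvg_itv_cut_powR].
by rewrite -[X in _ --> X](mul0r (1 : R)); apply: cvgM;
  [exact: cvg_itv_cut_powR|exact: cvg_onem_itv_cut_powR].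
Qed.

(* Integrate the derivative of t^u (1 - t)^v. *)
Lemma ebeta_swap u v : 0 < u -> 0 < v ->
  (u%:E * ebeta u (v + 1) = v%:E * ebeta (u + 1) v)%E.
Proof.
move=> u0 v0.
pose X n := (u%:E * \int[leb]_(t in `[itv_cut n, (1 - itv_cut n)%R]) (betaf u (v + 1) t)%:E)%E.
pose Y n := (v%:E * \int[leb]_(t in `[itv_cut n, (1 - itv_cut n)%R]) (betaf (u + 1) v t)%:E)%E.
pose d n := (1 - itv_cut n) `^ u * (1 - (1 - itv_cut n)) `^ v -
  itv_cut n `^ u * (1 - itv_cut n) `^ v.
have cX : X @ \oo --> (u%:E * ebeta u (v + 1))%E.
  by apply: cvgeZl => //; exact: cvg_ebeta.
have cY : Y @ \oo --> (v%:E * ebeta (u + 1) v)%E.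
  by apply: cvgeZl => //; exact: cvg_ebeta.
(* The fundamental theorem of calculus on the cut interval, in additive form: [d n] is the finite
   boundary term tending to 0, whereas the limits of [X] and [Y] may still be infinite. *)
have XY n : X n = ((d n)%:E + Y n)%E.
  have a0 := itv_cut_gt0 n; have al := itv_cut_lt n.
  have -> : (d n)%:E = (\int[leb]_(x in `[itv_cut n, (1 - itv_cut n)%R])
      (u * betaf u (v + 1) x - v * betaf (u + 1) v x)%:E)%E.
    apply/esym/(@FTC_itv01 R (fun t => t `^ u * (1 - t) `^ v)) => //.
    - by rewrite ltrBlDr ltrDl itv_cut_gt0.
    - by move=> x; exact: is_derive_betaf.
    - move=> x xI; apply: continuousB; (apply: continuousM; first exact: cst_continuous);
      exact: continuous_betaf.
  rewrite /X /Y.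
  rewrite -!ge0_integralZl //; last 6 first.
  - by apply/measurable_EFinP; apply: measurable_funS (measurable_betaf _ _).
  - by move=> x _; rewrite lee_fin betaf_ge0.
  - by rewrite lee_fin ltW.
  - by apply/measurable_EFinP; apply: measurable_funS (measurable_betaf _ _).
  - by move=> x _; rewrite lee_fin betaf_ge0.
  - by rewrite lee_fin ltW.
  have sub (x : R) : x \in `[itv_cut n, 1 - itv_cut n] -> x \in `]0, 1[.
    by rewrite !in_itv /= => /andP[? ?]; apply/andP; split; lra.
  have cI (g : R -> R) : (forall x, x \in `]0, 1[ -> {for x, continuous g}) ->
      leb.-integrable `[itv_cut n, 1 - itv_cut n] (EFin \o g).
    move=> cg; apply: continuous_compact_integrable; first exact: segment_compact.
    by apply: continuous_in_subspaceT => x; rewrite inE => /sub; exact: cg.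
  rewrite -integralD //; last 2 first.
  - apply: cI => x xI; apply: continuousB; (apply: continuousM; first exact: cst_continuous);
    exact: continuous_betaf.
  - apply: (cI (fun x => v * betaf (u + 1) v x)) => x xI.
    by apply: continuousM; [exact: cst_continuous|exact: continuous_betaf].
  by apply: eq_integral => x _; rewrite -EFinM -EFinD subrK.
have cXY : X @ \oo --> (0 + v%:E * ebeta (u + 1) v)%E.
  rewrite (_ : X = (fun n => (d n)%:E + Y n)%E); last exact/funext.
  apply: cvgeD => //.
  by apply/cvg_EFin; [near=> n|exact: cvg_itv_cut_boundary].
rewrite -[RHS]add0e; apply: cvg_unique cX cXY => //.
Unshelve. all: by end_near. Qed.

End euler_beta.

Section euler_beta_theory.
Context (R : realType).
Local Notation leb := (@lebesgue_measure R).
Implicit Types u v x t : R.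

Lemma ebeta_add u v :
  (ebeta u v = ebeta u (v + 1) + ebeta (u + 1) v)%E.
Proof.
rewrite /ebeta -ge0_integralD //; last 4 first.
- by move=> x _; rewrite lee_fin betaf_ge0.
- by apply/measurable_EFinP; apply: measurable_funS (measurable_betaf _ _).
- by move=> x _; rewrite lee_fin betaf_ge0.
- by apply/measurable_EFinP; apply: measurable_funS (measurable_betaf _ _).
by apply: eq_integral => x; rewrite inE => xI; rewrite -EFinD -betaf_split.
Qed.

Lemma powR_le1 (x p : R) : 0 <= p -> 0 <= x <= 1 -> x `^ p <= 1.
Proof.
move=> p0 /andP[x0 x1]; have E : 1 `^ p = 1 :> R by rewrite powR1.
by rewrite -[leRHS]E ge0_ler_powR // nnegrE.
Qed.

Lemma ebeta_ge1_lty u v : 1 <= u -> 1 <= v -> (ebeta u v < +oo)%E.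
Proof.
move=> u1 v1; apply: (@le_lt_trans _ _ (\int[leb]_(t in `]0%R, 1%R[) 1)%E).
  apply: ge0_le_integral => //.
  - by move=> x _; rewrite lee_fin betaf_ge0.
  - by apply/measurable_EFinP; apply: measurable_funS (measurable_betaf _ _).
  move=> x /=; rewrite in_itv /= => /andP[x0 x1]; rewrite lee_fin.
  by rewrite mulr_ile1 ?powR_ge0 // powR_le1 ?subr_ge0 // ?gerBl ?ltW.
rewrite integral_cst //= mul1e lebesgue_measure_itv /= lte_fin ltr01 /=.
by rewrite -EFinD ltry.
Qed.

(* ebeta_swap and ebeta_add reduce finiteness at (u, v) to finiteness at
   (u + 1, v + 1), where the integrand is bounded by 1. *)
Lemma ebeta_lty u v : 0 < u -> 0 < v -> (ebeta u v < +oo)%E.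
Proof.
move=> u0 v0.
have swap (a b : R) : 0 < a -> 0 < b ->
    ((ebeta a (b + 1) < +oo) = (ebeta (a + 1) b < +oo))%E.
  have lty (c : R) (x : \bar R) : 0 < c -> ((c%:E * x < +oo) = (x < +oo))%E.
    by move=> c0; rewrite -[in LHS](gt0_muley (x := c%:E)) // lte_pmul2l.
  by move=> a0 b0; rewrite -(lty a) // (ebeta_swap a0 b0) lty.
have H : (ebeta u (v + 1) < +oo)%E.
  rewrite ebeta_add lte_add_pinfty //.
    by rewrite swap ?addr_gt0 // ebeta_ge1_lty ?lerDr ?ltW.
  by rewrite ebeta_ge1_lty ?lerDr ?ltW.
by rewrite ebeta_add lte_add_pinfty // -swap.
Qed.

Lemma integral_gt0_itv (f : R -> R) (a b : R) : a < b ->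
  measurable_fun [set: R] f -> (forall x, 0 <= f x) ->
  (forall x, x \in `]a, b[ -> 0 < f x) ->
  (0 < \int[leb]_(x in `]a, b[) (f x)%:E)%E.
Proof.
move=> ab mf f0 fp; rewrite integral_mkcond.
apply: (@integral_gt0 _ _ _ leb `]a, b[%classic) => //.
- apply/(measurable_restrictT _ _).1 => //.
  by apply/measurable_EFinP; exact: measurable_funS mf.
- by move=> x; rewrite patchE; case: ifPn => // _; rewrite lee_fin.
- by move=> x xab; rewrite patchE mem_set // lte_fin fp.
- by rewrite /= lebesgue_measure_itv /= lte_fin ab -EFinB lte_fin subr_gt0.
Qed.

Lemma euler_betaE u v : 0 < u -> 0 < v -> (euler_beta u v)%:E = ebeta u v.
Proof.
move=> u0 v0; rewrite /euler_beta /Rintegral fineK.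
  apply: integral_itv_bndoo.
  by apply/measurable_EFinP; apply: measurable_funS (measurable_betaf _ _).
rewrite integral_itv_bndoo; last first.
  by apply/measurable_EFinP; apply: measurable_funS (measurable_betaf _ _).
by rewrite ge0_fin_numE ?ebeta_ge0 // ebeta_lty.
Qed.

Lemma euler_beta_gt0 u v : 0 < u -> 0 < v -> 0 < euler_beta u v.
Proof.
move=> u0 v0; rewrite -lte_fin euler_betaE //; apply: integral_gt0_itv => //.
- exact: measurable_betaf.
- exact: betaf_ge0.
move=> x; rewrite in_itv /= => /andP[x0 x1].
by rewrite mulr_gt0 ?powR_gt0 // subr_gt0.
Qed.

(** Eliminate B(u, v + 1) between u B(u, v + 1) = v B(u + 1, v) and B(u, v) = B(u, v + 1) + B(u + 1,
    v). *)
Lemma euler_betaS u v : 0 < u -> 0 < v ->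
  euler_beta u v = (u + v) / u * euler_beta (u + 1) v.
Proof.
move=> u0 v0.
have E1 : u * euler_beta u (v + 1) = v * euler_beta (u + 1) v.
  apply: EFin_inj; rewrite !EFinM !euler_betaE ?addr_gt0 //; exact: ebeta_swap.
have -> : euler_beta u v = euler_beta u (v + 1) + euler_beta (u + 1) v.
  apply: EFin_inj; rewrite EFinD !euler_betaE ?addr_gt0 //; exact: ebeta_add.
have u_neq0 : u != 0 by rewrite gt_eqF.
by apply: (mulfI u_neq0); rewrite mulrDr E1; field.
Qed.

(** On []0, 1[] the power t^(u - 1) decreases as u grows. *)
Lemma euler_beta_decr u u' v : 0 < u -> u <= u' -> 0 < v ->
  euler_beta u' v <= euler_beta u v.
Proof.
move=> u0 uu' v0; have u'0 := lt_le_trans u0 uu'; rewrite -lee_fin !euler_betaE //.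
apply: ge0_le_integral => //.
- by move=> x _; rewrite lee_fin betaf_ge0.
- by apply/measurable_EFinP; apply: measurable_funS (measurable_betaf _ _).
- by apply/measurable_EFinP; apply: measurable_funS (measurable_betaf _ _).
move=> x /=; rewrite in_itv /= => /andP[x0 x1]; rewrite lee_fin.
apply: ler_wpM2r; first exact: powR_ge0.
by apply: ger_powR; [rewrite x0 ltW|rewrite lerD2r].
Qed.

End euler_beta_theory.

(** * Beta quotients as limits of finite products *)

Section ratio_limits.
Context (R : realType).
Implicit Types (u v s a b c d x y r : R).

Lemma cvg_affine_inv c d : 0 < d -> (fun n => (c + d * n%:R)^-1) @ \oo --> (0 : R).
Proof.
move=> d0; apply/gtr0_cvgV0.
  near=> n; have : - c / d < n%:R by near: n; exact: nbhs_infty_gtr.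
  by rewrite ltr_pdivrMr // mulrC; lra.
apply/cvgryPge => A; near=> n.
have : (A - c) / d <= n%:R by near: n; exact: nbhs_infty_ger.
by rewrite ler_pdivrMr // mulrC; lra.
Unshelve. all: by end_near. Qed.

(** Division gives b / d plus a constant multiple of 1 / (c + d n). *)
Lemma cvg_affine_ratio a b c d : 0 < d ->
  (fun n => (a + b * n%:R) / (c + d * n%:R)) @ \oo --> b / d.
Proof.
move=> d0.
have H : (fun n => b / d + (a - b * c / d) * (c + d * n%:R)^-1) @ \oo --> b / d.
  rewrite -[X in _ --> X]addr0 -[X in _ --> _ + X](mulr0 (a - b * c / d)).
  apply: cvgD; first exact: cvg_cst.
  by apply: cvgM; [exact: cvg_cst|exact: cvg_affine_inv].
apply: cvg_trans H; apply: near_eq_cvg; near=> n.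
have : - c / d < n%:R by near: n; exact: nbhs_infty_gtr.
rewrite ltr_pdivrMr // mulrC => dn.
have dn0 : c + d * n%:R != 0 by rewrite gt_eqF //; lra.
have d_neq0 : d != 0 by rewrite gt_eqF.
by field; rewrite dn0.
Unshelve. all: by end_near. Qed.

Lemma euler_beta_prod u v n : 0 < u -> 0 < v ->
  euler_beta u v =
  \prod_(i < n) ((u + v + i%:R) / (u + i%:R)) * euler_beta (u + n%:R) v.
Proof.
move=> u0 v0; elim: n => [|n IH]; first by rewrite big_ord0 mul1r addr0.
have un : 0 < u + n%:R by rewrite ltr_wpDr.
rewrite IH big_ord_recr /= -mulrA; congr (_ * _).
by rewrite (euler_betaS un v0) -natr1 addrA (addrAC u n%:R v).
Qed.

(** For an integer shift, each application of the functional equation contributes a factor tending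
    to 1. A real shift s is squeezed, by monotonicity, between an integer N >= s and 0. *)
Lemma cvg_euler_beta_shift u v s : 0 < u -> 0 < v -> 0 <= s ->
  (fun n => euler_beta (u + s + n%:R) v / euler_beta (u + n%:R) v) @ \oo --> (1 : R).
Proof.
move=> u0 v0 s0.
have un n : 0 < u + n%:R :> R by rewrite ltr_wpDr.
have Bp n : 0 < euler_beta (u + n%:R) v by exact: euler_beta_gt0.
have [N sN] : exists N, s <= N%:R :> R.
  by exists (Num.bound s); rewrite ltW // archi_boundP.
have cN : (fun n => euler_beta (u + N%:R + n%:R) v / euler_beta (u + n%:R) v)
    @ \oo --> (1 : R).
  elim: (N) => [|M IH].
    rewrite [X in X @ _](_ : _ = cst 1); first exact: cvg_cst.
    by apply/funext => n /=; rewrite addr0 divff // gt_eqF.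
  have H : (fun n => euler_beta (u + M%:R + n%:R) v / euler_beta (u + n%:R) v *
     ((u + M%:R + 1 * n%:R) / (u + M%:R + v + 1 * n%:R))) @ \oo --> (1 : R).
    rewrite -[X in _ --> X](mul1r (1 : R)); apply: cvgM => //.
    by have := @cvg_affine_ratio (u + M%:R) 1 (u + M%:R + v) 1 (@ltr01 R); rewrite divr1.
  apply: cvg_trans H; apply: near_eq_cvg; near=> n.
  have uM : 0 < u + M%:R + n%:R by rewrite ltr_wpDr.
  rewrite (euler_betaS uM v0) -natr1 !mul1r.
  rewrite (_ : u + (M%:R + 1) + n%:R = u + M%:R + n%:R + 1); last by ring.
  have h1 : u + M%:R + n%:R != 0 by rewrite gt_eqF.
  have h2 : u + M%:R + v + n%:R != 0 by rewrite gt_eqF // addrAC addr_gt0.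
  have h3 : euler_beta (u + n%:R) v != 0 by rewrite gt_eqF.
  by field; rewrite h1 h2 h3.
apply: (@squeeze_cvgr _ _ _ _ (fun n =>
    euler_beta (u + N%:R + n%:R) v / euler_beta (u + n%:R) v) (cst 1)) => //.
  near=> n; rewrite ler_pM2r ?invr_gt0 //= ler_pdivrMr // mul1r.
  by apply/andP; split; apply: euler_beta_decr => //;
    rewrite ?ltr_wpDr ?ltr_wpDl ?lerD2r ?lerD2l ?lerDl //.
exact: cvg_cst.
Unshelve. all: by end_near. Qed.

(** The quotient of Pochhammer symbols (a + s)_n / (a)_n, a finite stand-in for a quotient of Gamma
    values. *)
Definition poch_ratio s n a := \prod_(i < n) ((a + s + i%:R) / (a + i%:R)).

Lemma poch_ratio_gt0 s n a : 0 < a -> 0 <= s -> 0 < poch_ratio s n a.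
Proof.
by move=> a0 s0; apply: prodr_gt0 => i _; rewrite divr_gt0 ?ltr_wpDr // ltr_wpDr.
Qed.

Lemma cvg_euler_beta_ratio u v s : 0 < u -> 0 < v -> 0 <= s ->
  (fun n => poch_ratio s n (u + v) / poch_ratio s n u) @ \oo -->
  euler_beta (u + s) v / euler_beta u v.
Proof.
move=> u0 v0 s0.
have us : 0 < u + s by rewrite ltr_wpDr.
have un n : 0 < u + n%:R :> R by rewrite ltr_wpDr.
have usn n : 0 < u + s + n%:R :> R by rewrite ltr_wpDr.
(* By [euler_beta_prod] at [u] and at [u + s], this sequence equals the quotient of the two
   [poch_ratio]; the inverted factor tends to 1. *)
have H : (fun n => euler_beta (u + s) v / euler_beta u v *
   (euler_beta (u + s + n%:R) v / euler_beta (u + n%:R) v)^-1) @ \oo -->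
   euler_beta (u + s) v / euler_beta u v.
  rewrite -[X in _ --> X]divr1.
  apply: cvgM; first exact: cvg_cst.
  by apply: cvgV; [exact: oner_neq0|exact: cvg_euler_beta_shift].
apply: cvg_trans H; apply: near_eq_cvg; near=> n.
rewrite (euler_beta_prod n u0 v0) (euler_beta_prod n us v0).
rewrite /poch_ratio -!prodf_div.
have b1 : euler_beta (u + s + n%:R) v != 0 by rewrite gt_eqF // euler_beta_gt0.
have b2 : euler_beta (u + n%:R) v != 0 by rewrite gt_eqF // euler_beta_gt0.
rewrite invf_div (_ : \prod_(i < n) ((u + s + v + i%:R) / (u + s + i%:R)) =
  \prod_(i < n) ((u + v + i%:R) / (u + i%:R)) *
  \prod_(i < n) ((u + v + s + i%:R) / (u + v + i%:R) / ((u + s + i%:R) / (u + i%:R)))).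
  have p0 : \prod_(i < n) ((u + v + i%:R) / (u + i%:R)) != 0.
    by rewrite gt_eqF // prodr_gt0 // => i _; rewrite divr_gt0 // ltr_wpDr // addr_gt0.
  by field; rewrite b1 b2 p0.
rewrite -big_split; apply: eq_bigr => i _ /=.
have h1 : u + i%:R != 0 by rewrite gt_eqF.
have h2 : u + s + i%:R != 0 by rewrite gt_eqF.
have h3 : u + v + i%:R != 0 by rewrite gt_eqF // addrAC addr_gt0.
by field; rewrite h1 h2 h3.
Unshelve. all: by end_near. Qed.

End ratio_limits.

(** * Truncated Gauss products *)

Section gauss_product.
Context (R : realType).
Implicit Types (u v s a b c d x y r : R).

(** The Pochhammer symbol (x + 1)_n. Starting at x + 1 matches the numerators r + j with j >= 1, and
    gives positivity for x > -1. *)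
Definition rising n x := \prod_(i < n) (x + i.+1%:R).

Lemma rising_gt0 n x : -1 < x -> 0 < rising n x.
Proof. by move=> x1; apply: prodr_gt0 => i _; rewrite -natr1; have := ler0n R i; lra. Qed.

Lemma rising_add m n x : rising (m + n) x = rising m x * rising n (x + m%:R).
Proof.
rewrite /rising big_split_ord /=; congr (_ * _); apply: eq_bigr => i _.
by rewrite -addnS natrD addrA.
Qed.

Lemma rising_nat n m : rising n m%:R = (m + n)`!%:R / m`!%:R.
Proof.
have m0 : m`!%:R != 0 :> R by rewrite pnatr_eq0 -lt0n fact_gt0.
elim: n => [|n IH]; first by rewrite addn0 divff // /rising big_ord0.
rewrite /rising big_ord_recr /= -/(rising n _) IH addnS factS natrM.
by rewrite -addnS natrD; field.
Qed.

Lemma big_nat_block (F : nat -> R) N n :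
  \prod_(i < n) \prod_(j < N) F (i * N + j)%N = \prod_(t < n * N) F t.
Proof.
elim: n => [|n IH]; first by rewrite mul0n !big_ord0.
by rewrite big_ord_recr /= IH mulSn addnC big_split_ord.
Qed.

(* The n-truncated Gauss multiplication formula is a mere regrouping of factors. *)
Lemma prod_poch_ratio r s N n : (0 < N)%N -> -1 < r -> 0 <= s ->
  \prod_(j < N) poch_ratio s n ((r + j.+1%:R) / N%:R) =
  rising (n * N) (r + N%:R * s) / rising (n * N) r.
Proof.
move=> N0 r1 s0; rewrite /poch_ratio exchange_big /= /rising -prodf_div.
rewrite -(big_nat_block (fun t => (r + N%:R * s + t.+1%:R) / (r + t.+1%:R))).
apply: eq_bigr => i _; apply: eq_bigr => j _.
have N_neq0 : N%:R != 0 :> R by rewrite pnatr_eq0 -lt0n.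
have p : 0 < r + (1 + j%:R + i%:R * N%:R).
  by have := mulr_ge0 (ler0n R i) (ler0n R N); have := ler0n R j; lra.
rewrite -addnS natrD natrM -natr1; field.
by rewrite N_neq0 /= gt_eqF //; move: p; lra.
Qed.


(** After division by x^(b + 1) it reads (1 + b/x) (1 - 1/x)^b <= e^(b/x) e^(-b/x) = 1. *)
Lemma powR_ineq_lower b x : 0 <= b -> 1 < x -> (x + b) * (x - 1) `^ b <= x * x `^ b.
Proof.
move=> b0 x1; have x0 : 0 < x by lra.
have xV : x * x^-1 = 1 by rewrite divff ?gt_eqF.
have xV0 : 0 < x^-1 by rewrite invr_gt0.
have xV1 : x^-1 < 1 by rewrite invf_lt1.
have -> : x - 1 = x * (1 - x^-1) by rewrite mulrBr xV mulr1.
have h1 : 0 <= 1 - x^-1 by rewrite subr_ge0 ltW.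
rewrite (powRM _ (ltW x0) h1) mulrCA [leRHS]mulrC; apply: ler_wpM2l; first exact: powR_ge0.
have e1 : (1 - x^-1) `^ b <= expR (- (b / x)).
  rewrite /powR gt_eqF ?subr_gt0 // ler_expR -mulrN ler_wpM2l //.
  by apply: le_ln1Dx; lra.
have e2 : x + b <= x * expR (b / x).
  have -> : x + b = x * (1 + b / x) by rewrite mulrDr mulr1 mulrCA xV mulr1.
  by rewrite ler_wpM2l ?expR_ge1Dx // ltW.
have xb : 0 <= x + b by rewrite addr_ge0 // ltW.
apply: le_trans (ler_pM xb (powR_ge0 _ _) e2 e1) _.
by rewrite -mulrA -expRD addrN expR0 mulr1.
Qed.

(** After division by y^(b + 1) it reads (1 - b/y) (1 + 1/y)^b <= e^(-b/y) e^(b/y) = 1. *)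
Lemma powR_ineq_upper b y : 0 <= b -> b < y -> (y - b) * (y + 1) `^ b <= y * y `^ b.
Proof.
move=> b0 yb; have y0 : 0 < y by lra.
have yV : y * y^-1 = 1 by rewrite divff ?gt_eqF.
have yV0 : 0 < y^-1 by rewrite invr_gt0.
have -> : y + 1 = y * (1 + y^-1) by rewrite mulrDr yV mulr1.
have h1 : 0 <= 1 + y^-1 by rewrite addr_ge0 // ltW.
rewrite (powRM _ (ltW y0) h1) mulrCA [leRHS]mulrC; apply: ler_wpM2l; first exact: powR_ge0.
have e1 : (1 + y^-1) `^ b <= expR (b / y).
  rewrite /powR gt_eqF ?addr_gt0 // ler_expR ler_wpM2l //.
  by apply: le_ln1Dx; lra.
have e2 : y - b <= y * expR (- (b / y)).
  have -> : y - b = y * (1 - b / y) by rewrite mulrBr mulr1 mulrCA yV mulr1.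
  by rewrite ler_wpM2l ?expR_ge1Dx // ltW.
have yb0 : 0 <= y - b by rewrite subr_ge0 ltW.
apply: le_trans (ler_pM yb0 (powR_ge0 _ _) e2 e1) _.
by rewrite -mulrA -expRD addNr expR0 mulr1.
Qed.

(** This decays like a constant times n^(-b). The next lemmas bound it through monotone quantities;
    in a quotient of two values the constant, a Gamma quotient, cancels. *)
Definition rising_ratio r b n := rising n r / rising n (r + b).

Lemma rising_ratioS r b n :
  rising_ratio r b n.+1 = rising_ratio r b n * ((r + n.+1%:R) / (r + b + n.+1%:R)).
Proof. by rewrite /rising_ratio /rising !big_ord_recr /= -mulf_div. Qed.

Lemma rising_ratio_gt0 r b n : -1 < r -> 0 <= b -> 0 < rising_ratio r b n.
Proof. by move=> r1 b0; rewrite divr_gt0 // rising_gt0 //; lra. Qed.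

(** One step from N to N + 1 is [powR_ineq_lower] at x = r + N + 1; the condition 0 < m ensures x >
    1. *)
Lemma rising_ratio_lower r b m n : -1 < r -> 0 <= b -> (0 < m)%N -> (m <= n)%N ->
  rising_ratio r b m * (r + m%:R) `^ b <= rising_ratio r b n * (r + n%:R) `^ b.
Proof.
move=> r1 b0 m0 /subnK <-; elim: (n - m)%N => // d IH.
apply: le_trans IH _; rewrite addSn; set N := (d + m)%N.
have N1 : 1 <= N%:R :> R by rewrite ler1n /N; lia.
rewrite rising_ratioS -mulrA ler_wpM2l //; first by rewrite ltW // rising_ratio_gt0.
have := @powR_ineq_lower b (r + N.+1%:R) b0; rewrite -natr1 => /(_ _)/wrap[]; first lra.
rewrite addrA addrK => H.
rewrite mulrAC ler_pdivlMr; last lra.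
rewrite [leLHS]mulrC (_ : r + b + (N%:R + 1) = r + N%:R + 1 + b); last ring.
exact: H.
Qed.

(** One step from N to N + 1 is [powR_ineq_upper] at y = r + b + 1 + N. *)
Lemma rising_ratio_upper r b m n : -1 < r -> 0 <= b -> (m <= n)%N ->
  rising_ratio r b n * (r + b + 1 + n%:R) `^ b <=
  rising_ratio r b m * (r + b + 1 + m%:R) `^ b.
Proof.
move=> r1 b0 /subnK <-; elim: (n - m)%N => // d IH.
apply: le_trans _ IH; rewrite addSn; set N := (d + m)%N.
have N0 := ler0n R N.
rewrite rising_ratioS -mulrA ler_wpM2l //; first by rewrite ltW // rising_ratio_gt0.
have := @powR_ineq_upper b (r + b + 1 + N%:R) b0; rewrite -natr1 => /(_ _)/wrap[]; first lra.
rewrite (_ : r + b + 1 + N%:R - b = r + (N%:R + 1)); last ring.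
rewrite (_ : r + b + 1 + N%:R + 1 = r + b + 1 + (N%:R + 1)); last ring.
rewrite (_ : r + b + (N%:R + 1) = r + b + 1 + N%:R); last ring.
move=> H; rewrite mulrAC ler_pdivrMr; last lra.
by rewrite [leRHS]mulrC.
Qed.

Lemma cvg_powR (f : R^nat) a b : 0 < a -> f @ \oo --> a -> (fun n => f n `^ b) @ \oo --> a `^ b.
Proof.
by move=> a0 cf; apply: (cvg_comp f (fun t => t `^ b) cf); exact: continuous_powR.
Qed.

(** The two monotonicity bounds between nA and nK squeeze the quotient between b-th powers of affine
    ratios in n, both with limit (A/K)^b. *)
Lemma cvg_rising_ratio r b (A K : nat) : -1 < r -> 0 <= b -> (0 < A)%N -> (A <= K)%N ->
  (fun n => rising_ratio r b (n * K) / rising_ratio r b (n * A)) @ \oo -->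
  (A%:R / K%:R : R) `^ b.
Proof.
move=> r1 b0 A0 AK; have K0 : (0 < K)%N by lia.
have A0R : 0 < A%:R :> R by rewrite ltr0n.
have K0R : 0 < K%:R :> R by rewrite ltr0n.
have AK0 : 0 < A%:R / K%:R :> R by rewrite divr_gt0.
apply: (@squeeze_cvgr _ _ _ _
  (fun n => ((r + A%:R * n%:R) / (r + K%:R * n%:R)) `^ b)
  (fun n => ((r + b + 1 + A%:R * n%:R) / (r + b + 1 + K%:R * n%:R)) `^ b)); last 2 first.
- by apply: cvg_powR => //; exact: cvg_affine_ratio.
- by apply: cvg_powR => //; exact: cvg_affine_ratio.
near=> n; have n0 : (0 < n)%N by near: n; exact: nbhs_infty_gt.
have nA : (0 < n * A)%N by rewrite muln_gt0 n0.
have nAK : (n * A <= n * K)%N by rewrite leq_mul2l AK orbT.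
have A1 : 1 <= A%:R * n%:R :> R by rewrite -natrM ler1n mulnC.
have K1 : 1 <= K%:R * n%:R :> R by rewrite -natrM ler1n muln_gt0 K0.
have pA : 0 < rising_ratio r b (n * A) by exact: rising_ratio_gt0.
have := rising_ratio_lower r1 b0 nA nAK.
have := rising_ratio_upper r1 b0 nAK.
rewrite !natrM ![n%:R * _]mulrC => U L.
have powRV (x : R) : 0 < x -> x^-1 `^ b = (x `^ b)^-1.
  by move=> x0; rewrite -powR_inv1 ?ltW // -powRrM mulN1r powRN.
have powR_div (x y : R) : 0 < x -> 0 < y -> (x / y) `^ b = x `^ b / y `^ b.
  by move=> x0 y0; rewrite powRM ?invr_ge0 ?ltW // powRV.
rewrite !powR_div; try lra.
have d1 : 0 < (r + K%:R * n%:R) `^ b by rewrite powR_gt0 //; lra.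
have d2 : 0 < (r + b + 1 + K%:R * n%:R) `^ b by rewrite powR_gt0 //; lra.
rewrite (ler_pdivlMr _ _ pA) (ler_pdivrMr _ _ pA); apply/andP; split.
  by rewrite mulrAC (ler_pdivrMr _ _ d1) mulrC.
by rewrite [leRHS]mulrAC (ler_pdivlMr _ _ d2) [leRHS]mulrC.
Unshelve. all: by end_near. Qed.

Lemma cvg_rising_quot (a b c d : R) m : 0 < d ->
  (fun n => rising m (a + c * n%:R) / rising m (b + d * n%:R)) @ \oo --> (c / d) ^+ m.
Proof.
move=> d0; elim: m => [|m IH].
  rewrite [X in X @ _](_ : _ = cst 1); first exact: cvg_cst.
  by apply/funext => n; rewrite /rising !big_ord0 divr1.
rewrite [X in X @ _](_ : _ = (fun n =>
  (rising m (a + c * n%:R) / rising m (b + d * n%:R)) *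
  ((a + m.+1%:R + c * n%:R) / (b + m.+1%:R + d * n%:R)))).
  by rewrite exprSr; apply: cvgM => //; exact: cvg_affine_ratio.
apply/funext => n; rewrite /rising !big_ord_recr /= -mulf_div.
by rewrite (addrAC a) (addrAC b).
Qed.

Lemma cvg_gbinom (k l m : nat) p r : (0 < l)%N -> (l < k)%N -> p = k%:R / l%:R ->
    -1 < r -> let s := m%:R / l%:R in
  (fun n =>
     (\prod_(i < l) poch_ratio s n (i.+1%:R / l%:R) *
      \prod_(i < k - l) poch_ratio s n ((r + i.+1%:R) / (k%:R - l%:R))) /
     \prod_(j < k) poch_ratio s n ((r + j.+1%:R) / k%:R)) @ \oo -->
  gbinom (m%:R * p + r) m / cp p ^+ m.
Proof.
move=> l0 lk pE r1 s.
have l0R : 0 < l%:R :> R by rewrite ltr0n.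
have lkR : l%:R < k%:R :> R by rewrite ltr_nat.
have l_neq0 : l%:R != 0 :> R by rewrite gt_eqF.
have k_neq0 : k%:R != 0 :> R by rewrite gt_eqF //; lra.
have s0 : 0 <= s by rewrite divr_ge0.
have AE : k%:R - l%:R = (k - l)%:R :> R by rewrite natrB // ltnW.
pose b : R := (k%:R - l%:R) * s.
have b0 : 0 <= b by rewrite mulr_ge0 // subr_ge0 ltW.
(* The falling product of m p + r, read backwards, is [rising m (r + b)], and c(p)^(-m) = p^(-m) ((p
   - 1) / p)^b. *)
have lim : gbinom (m%:R * p + r) m / cp p ^+ m =
    rising m (r + b) / m`!%:R * (l%:R / k%:R) ^+ m * ((k - l)%:R / k%:R) `^ b.
  have p1 : 1 < p by rewrite pE ltr_pdivlMr // mul1r.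
  have p0 : 0 < p by lra.
  have bE : b = (p - 1) * m%:R by rewrite /b /s pE; field.
  have -> : gbinom (m%:R * p + r) m = rising m (r + b) / m`!%:R.
    congr (_ / _); rewrite [RHS](reindex_inj rev_ord_inj); apply: eq_bigr => i _ /=.
    by rewrite bE subnSK // natrB 1?ltnW //; ring.
  have -> : l%:R / k%:R = p^-1 by rewrite pE invf_div.
  have -> : (k - l)%:R / k%:R = (p - 1) / p by rewrite -AE pE; field; apply/andP.
  rewrite -[RHS]mulrA; congr (_ * _); apply/eqP.
  have powE (x y : R) : 0 < x -> x `^ y = expR (y * ln x) by move=> x0; rewrite /powR gt_eqF.
  have pV : p^-1 = expR (- ln p) by rewrite expRN lnK.
  rewrite /cp !powE ?divr_gt0 //; try lra.
  rewrite ln_div ?posrE //; last lra.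
  rewrite pV -expRD -!expRM_natl -expRD -expRN bE; apply/eqP; congr expR; ring.
have H : (fun n => rising m (r + b) / m`!%:R *
    (rising m (0 + l%:R * n%:R) / rising m (r + b + k%:R * n%:R)) *
    (rising_ratio r b (n * k) / rising_ratio r b (n * (k - l)))) @ \oo -->
    rising m (r + b) / m`!%:R * (l%:R / k%:R) ^+ m * ((k - l)%:R / k%:R) `^ b.
  apply: cvgM; last by apply: cvg_rising_ratio => //; lia.
  apply: cvgM; first exact: cvg_cst.
  by apply: cvg_rising_quot; lra.
rewrite lim; apply: cvg_trans H.
apply: near_eq_cvg; near=> n.
(* This is the Gauss product with r = 0; since l s = m is an integer, both rising products are
   quotients of factorials. *)
have -> : \prod_(i < l) poch_ratio s n (i.+1%:R / l%:R) =
    rising m (l%:R * n%:R) / m`!%:R.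
  under eq_bigr do rewrite -[X in X / _]add0r.
  rewrite prod_poch_ratio ?ltrN10 //.
  rewrite (_ : 0 + l%:R * s = m%:R); last by rewrite add0r mulrC divfK.
  rewrite -natrM -(mulr0n 1) !rising_nat fact0 divr1 addnC mulnC.
  have f0 (i : nat) : i`!%:R != 0 :> R by rewrite pnatr_eq0 -lt0n fact_gt0.
  by field; rewrite !f0.
rewrite AE !prod_poch_ratio //; try lia.
rewrite -AE -/b.
have -> : r + k%:R * s = r + b + m%:R by rewrite /b /s; field.
(* Splitting [rising (m + n * k) (r + b)] in both orders trades the long product starting at r + b +
   m for one starting at r + b and two products of length m. *)
have E := rising_add m (n * k) (r + b).
rewrite addnC rising_add natrM mulrC [n%:R * _]mulrC in E.
have g0 N (x : R) : -1 < x -> rising N x != 0.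
  by move=> x1; rewrite gt_eqF // rising_gt0.
have kn : 0 <= k%:R * n%:R :> R by rewrite mulr_ge0.
have nk0 : rising (n * k) (r + b) != 0 by apply: g0; lra.
have -> : rising m (r + b + k%:R * n%:R) =
    rising m (r + b) * rising (n * k) (r + b + m%:R) / rising (n * k) (r + b).
  by rewrite -E mulfK.
rewrite /rising_ratio add0r; field.
have m0 := ler0n R m.
rewrite !g0 ?pnatr_eq0 -?lt0n ?fact_gt0 //; lra.
Unshelve. all: by end_near. Qed.

End gauss_product.

(** * The parameters of the beta factors *)

Section alpha_parameters.
Context (R : realType) (k l : nat) (r : R).
Hypotheses (l0 : (0 < l)%N) (lk : (l < k)%N) (r1 : -1 < r) (rk : r <= k%:R / l%:R - 1).
Local Notation j' := (jprime k l r).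

Let l0R : 0 < l%:R :> R. Proof. by rewrite ltr0n. Qed.
Let lkR : l%:R < k%:R :> R. Proof. by rewrite ltr_nat. Qed.
Let kR0 : 0 < k%:R :> R. Proof. exact: lt_trans lkR. Qed.
Let kl1 : 1 < k%:R / l%:R :> R. Proof. by rewrite ltr_pdivlMr // mul1r. Qed.

Lemma jprimeE i : (0 < i <= l)%N -> j' i = Num.floor (i%:R * k%:R / l%:R - r).
Proof. by move=> /andP[i0 il]; by rewrite /jprime !ifF //; lia. Qed.

(** Consecutive arguments of the floor differ by k/l > 1. At the ends, r <= k/l - 1 gives j'_1 >= 1,
    and r > -1 gives j'_l < k + 1. *)
Lemma jprimeSn_lt i : (i <= l)%N -> j' i < j' i.+1.
Proof.
move=> il; have [->|i0] := posnP i.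
  rewrite (jprimeE (i := 1)) ?l0 // gtz0_ge1 floor_ge_int mul1r mulr1z.
  by rewrite lerBrDr addrC -lerBrDr.
have [->|il'] := eqVneq i l.
  rewrite jprimeE ?l0 ?leqnn // /jprime /= eqxx.
  by rewrite floor_lt_int mulrAC divff ?gt_eqF // mul1r -pmulrn -natr1
    ltrBlDl addrCA ltrDl -ltrBlDr sub0r.
rewrite !jprimeE ?i0 //; last lia.
rewrite -lezD1 floor_ge_int rmorphD /= mulr1z -natr1 mulrDl mul1r mulrDl.
have := floor_le (i%:R * k%:R / l%:R - r); move: kl1.
set q := k%:R / l%:R; set t := i%:R * k%:R / l%:R; lra.
Qed.

Lemma jprime_lt a b : (a < b)%N -> (b <= l.+1)%N -> j' a < j' b.
Proof.
elim: b => // b IH; rewrite ltnS leq_eqVlt => /predU1P[-> bl|ab bl].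
  exact: jprimeSn_lt.
apply: lt_trans (IH ab _) (jprimeSn_lt _); lia.
Qed.

Lemma jprime_le a b : (a <= b)%N -> (b <= l.+1)%N -> j' a <= j' b.
Proof.
rewrite leq_eqVlt => /predU1P[->//|ab bl]; exact/ltW/jprime_lt.
Qed.

Lemma jprime_interval_inj a b (j : int) : (a <= l)%N -> (b <= l)%N ->
  j' a <= j < j' a.+1 -> j' b <= j < j' b.+1 -> a = b.
Proof.
move=> al bl /andP[aj ja] /andP[bj jb].
have [ab|ba|//] := ltngtP a b.
  by have := jprime_le (a := a.+1) (b := b) ab; lia.
by have := jprime_le (a := b.+1) (b := a) ba; lia.
Qed.

(** The half-open blocks [j'_i, j'_(i+1)[ are disjoint, so both picks can only return the index i of
    the block containing j; its left end separates the two cases. *)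
Lemma talphaE i j : (i <= l)%N -> (0 < j)%N -> j' i <= j%:Z < j' i.+1 ->
  talpha k l r j = if j%:Z == j' i then i%:R / l%:R
                   else (r + j%:R - i%:R) / (k%:R - l%:R).
Proof.
move=> il j0 ij; rewrite /talpha; case: pickP => [a /andP[a0 /eqP ja]|none].
  have al : (a <= l)%N by rewrite -ltnS.
  have -> : i = a.
    apply: (jprime_interval_inj (j := j)) => //.
    by rewrite ja lexx jprimeSn_lt.
  by rewrite ja eqxx.
have ne : j%:Z != j' i.
  have := none (Ordinal (il : (i < l.+1)%N)) => /=.
  case: i il ij => [|i] il ij /=; last by move=> ->.
  by rewrite /jprime /= => _; lia.
rewrite (negbTE ne); case: pickP => [a /andP[ja1 ja2]|].
  have al : (a <= l)%N by rewrite -ltnS.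
  rewrite (jprime_interval_inj (a := i) (b := a) (j := j)) //.
  by rewrite ja2 ltW.
move=> /(_ (Ordinal (il : (i < l.+1)%N))) /=.
by move: ij ne => /andP[ij ->]; rewrite andbT lt_neqAle ij eq_sym => ->.
Qed.

(** Both comparisons amount to comparing i k with l (r + j), and the floor in j'_i decides it: l (r
    + j) <= i k when j = j'_i, and i k < l (r + j) when j > j'_i. *)
Lemma beta_le_alpha i j : (i <= l)%N -> (0 < j)%N -> j' i <= j%:Z < j' i.+1 ->
  if j%:Z == j' i then beta_ k r j <= talpha k l r j
  else beta_ k r j < talpha k l r j.
Proof.
move=> il j0 ij; rewrite (talphaE il) //; case: ifPn => ji; rewrite /beta_.
  have i0 : (0 < i)%N by case: i il ij ji => // il ij; rewrite /jprime /= => /eqP; lia.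
  have : j%:Z%:~R <= i%:R * k%:R / l%:R - r.
    by rewrite -floor_ge_int -jprimeE ?i0 // (eqP ji).
  rewrite -pmulrn => H.
  by rewrite ji ler_pdivrMr // mulrAC addrC -lerBrDr.
have H : i%:R * k%:R < l%:R * (r + j%:R).
  have [i0|i0] := posnP i.
    have j1 : 1 <= j%:R :> R by rewrite ler1n.
    by rewrite i0 mul0r mulr_gt0 // -ltrBlDr sub0r (le_lt_trans _ r1) // lerN2.
  have : i%:R * k%:R / l%:R - r < j%:Z%:~R.
    by rewrite -floor_lt_int -jprimeE ?i0 // lt_neqAle eq_sym ji; case/andP: ij.
  by rewrite -pmulrn ltrBlDr ltr_pdivrMr // => h; rewrite [ltRHS]mulrC addrC.
rewrite (negbTE ji) ltr_pdivrMr // mulrAC ltr_pdivlMr ?subr_gt0 //; move: H; lra.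
Qed.

Lemma jprime_locate n : (n <= k)%N -> exists2 i, (i <= l)%N & j' i <= n%:Z < j' i.+1.
Proof.
elim: n => [_|n IH nk].
  by exists 0%N => //; have := jprimeSn_lt (leq0n l); rewrite /jprime /=; lia.
have [i il /andP[ji nj]] := IH (ltnW nk).
have [e|ne] := eqVneq (n.+1%:Z) (j' i.+1); last first.
  by exists i => //; lia.
have il' : (i < l)%N.
  rewrite ltn_neqAle il andbT; apply/eqP => E.
  by move: e; rewrite E /jprime /= eqxx; lia.
by exists i.+1 => //; have := jprimeSn_lt il'; lia.
Qed.

Lemma beta_le_talpha j : (0 < j <= k)%N -> beta_ k r j <= talpha k l r j.
Proof.
move=> /andP[j0 jk]; have [i il ij] := jprime_locate jk.
by have := beta_le_alpha il j0 ij; case: ifP => // _ /ltW.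
Qed.

(** Here i counts the j'_1, ..., j'_i that are at most n. If n + 1 is the next one, it contributes
    (i + 1) / l to the first product; otherwise it contributes (r + (n + 1 - i)) / (k - l), the next
    term of the second, and a strict inequality. *)
Lemma talpha_prod_aux (F : R -> R) n : (n <= k)%N -> exists i,
  [/\ (i <= l)%N, (i <= n)%N, j' i <= n%:Z < j' i.+1,
      (i < n)%N -> exists2 j, (0 < j <= n)%N & beta_ k r j < talpha k l r j &
      \prod_(j < n) F (talpha k l r j.+1) =
      \prod_(j < i) F (j.+1%:R / l%:R) *
      \prod_(j < n - i) F ((r + j.+1%:R) / (k%:R - l%:R))].
Proof.
elim: n => [_|n IH nk].
  exists 0%N; split=> //; last by rewrite !big_ord0 mulr1.
  by have := jprimeSn_lt (leq0n l); rewrite /jprime /=; lia.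
have [i [il ii /andP[ji nj] ex E]] := IH (ltnW nk).
have [e|ne] := eqVneq (n.+1%:Z) (j' i.+1).
  have il' : (i < l)%N.
    rewrite ltn_neqAle il andbT; apply/eqP => E'.
    by move: e; rewrite E' /jprime /= eqxx; lia.
  have ij : j' i.+1 <= n.+1%:Z < j' i.+2 by have := jprimeSn_lt il'; lia.
  exists i.+1; split => //.
    by rewrite ltnS => /ex [j jn jlt]; exists j => //; lia.
  by rewrite big_ord_recr /= E (talphaE il') // e eqxx [in RHS]big_ord_recr /= mulrAC subSS.
have ij : j' i <= n.+1%:Z < j' i.+1 by lia.
have ne' : n.+1%:Z == j' i = false by lia.
exists i; split => //; first lia.
  by exists n.+1; [lia|have := beta_le_alpha il (ltn0Sn n) ij; rewrite ne'].
rewrite big_ord_recr /= E (talphaE il) // ne' subSn // [in RHS]big_ord_recr /= mulrA.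
by congr (_ * F (_ / _)); rewrite -subSn // natrB ?addrA //; lia.
Qed.

Lemma jprime_last i : (i <= l)%N -> k%:Z < j' i.+1 -> i = l.
Proof.
move=> il ki; apply/eqP; rewrite eqn_leq il leqNgt; apply/negP => li.
have := jprime_le (a := i.+1) (b := l) li (leqnSn l).
have := jprimeSn_lt (leqnn l); rewrite {2}/jprime /= eqxx; lia.
Qed.

Lemma talpha_prod (F : R -> R) :
  \prod_(j < k) F (talpha k l r j.+1) =
  \prod_(j < l) F (j.+1%:R / l%:R) *
  \prod_(j < k - l) F ((r + j.+1%:R) / (k%:R - l%:R)).
Proof.
have [i [il ii /andP[_ ki] _ E]] := talpha_prod_aux F (leqnn k).
by rewrite E (jprime_last il ki).
Qed.

(** Only l < k of the indices are of the form j'_i; any other one is strict. *)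
Lemma beta_lt_talpha : exists2 j, (0 < j <= k)%N & beta_ k r j < talpha k l r j.
Proof.
have [i [il ii /andP[_ ki] ex _]] := talpha_prod_aux id (leqnn k).
by apply: ex; rewrite (jprime_last il ki).
Qed.

End alpha_parameters.

(** * Modified beta integrals *)

Section modified_beta_integral.
Context (R : realType).
Local Notation leb := (@lebesgue_measure R).
Implicit Types u v l x t : R.

(** The density of b(u + v, u, l) before division by B(u, v). *)
Definition mbetaf u v l x : R := l * (x `^ (l * u - 1) * (1 - x `^ l) `^ (v - 1)).

Lemma measurable_mbetaf u v l : measurable_fun [set: R] (mbetaf u v l).
Proof.
apply: measurable_funM => //; apply: measurable_funM => //.
apply: (@measurableT_comp _ _ _ _ _ _ (fun t : R => (1 - t) `^ (v - 1))).
  exact: measurable_powR_onem.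
exact: measurable_powR.
Qed.

Lemma mbetaf_ge0 u v l x : 0 <= l -> 0 <= mbetaf u v l x.
Proof. by move=> l0; rewrite !mulr_ge0 ?powR_ge0. Qed.

Lemma powR_lt1 (x p : R) : 0 < p -> 0 < x < 1 -> x `^ p < 1.
Proof.
move=> p0 /andP[x0 x1]; have E : 1 `^ p = 1 :> R by rewrite powR1.
by rewrite -[ltRHS]E gt0_ltr_powR // nnegrE ?ltW.
Qed.

Lemma mbetaf_gt0 u v l x : 0 < l -> x \in `]0, 1[ -> 0 < mbetaf u v l x.
Proof.
rewrite in_itv /= => l0 x01; have /andP[x0 x1] := x01.
by rewrite !mulr_gt0 ?powR_gt0 ?subr_gt0 ?powR_lt1.
Qed.

(** Substitution t = x^l on the cut intervals, followed by a passage to the limit. *)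
Lemma integral_mbetaf u v l : 0 < l ->
  (\int[leb]_(x in `]0%R, 1%R[) (mbetaf u v l x)%:E = ebeta u v)%E.
Proof.
move=> l0.
have cR : (\int[leb]_(x in `[itv_cut R n, (1 - itv_cut R n)%R]) (mbetaf u v l x)%:E
    @[n --> \oo] --> \int[leb]_(x in `]0%R, 1%R[) (mbetaf u v l x)%:E)%E.
  apply: cvg_integral_itv01 => //.
  - exact: measurable_mbetaf.
  - by move=> x; exact: mbetaf_ge0 (ltW l0).
  - exact: itv_cut_nonincreasing.
  - by move=> m n mn; rewrite lerD2l lerN2; exact: itv_cut_nonincreasing.
  - exact: itv_cut_gt0.
  - by move=> n; rewrite ltrBlDr ltrDl itv_cut_gt0.
  - exact: itv_cut_cvg0.
  - exact: onem_itv_cut_cvg1.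
have cut01 n : 0 < itv_cut R n < 1 by have := itv_cut_gt0 R n; have := itv_cut_lt R n; lra.
have pow_homo (x y : R) : 0 <= x -> x <= y -> x `^ l <= y `^ l.
  by move=> x0 xy; apply: (ge0_ler_powR (ltW l0)) => //; rewrite nnegrE // (le_trans x0).
(* The images of the cut intervals under x^l also exhaust []0, 1[]. *)
have cL : (\int[leb]_(x in `[(itv_cut R n `^ l)%R, ((1 - itv_cut R n) `^ l)%R]) (betaf u v x)%:E
    @[n --> \oo] --> ebeta u v)%E.
  apply: cvg_integral_itv01 => //.
  - exact: measurable_betaf.
  - by move=> x; exact: betaf_ge0.
  - by move=> m n mn; apply: pow_homo; [exact/ltW/itv_cut_gt0|exact: itv_cut_nonincreasing].
  - move=> m n mn; apply: pow_homo; first by have /andP[_ /ltW] := cut01 m; rewrite subr_ge0.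
    by rewrite lerD2l lerN2; exact: itv_cut_nonincreasing.
  - by move=> n; rewrite powR_gt0 // itv_cut_gt0.
  - by move=> n; apply: powR_lt1 => //; have := cut01 n; lra.
  - exact: cvg_itv_cut_powR.
  - exact: cvg_onem_itv_cut_powR.
apply: cvg_unique cR _ => //; apply: cvg_trans cL; apply: near_eq_cvg; near=> n.
have dpow (x : R) : x \in `]0, 1[ -> is_derive x 1 (fun t => t `^ l) (l * x `^ (l - 1)).
  by rewrite in_itv /= => /andP[x0 _]; exact: is_derive1_powR.
rewrite (@substitution_itv01 _ (fun t => t `^ l) (fun x => l * x `^ (l - 1))) //.
- apply: eq_integral => x; rewrite inE /= in_itv /= => /andP[x0 _].
  have {}x0 : 0 < x by apply: lt_le_trans x0; exact: itv_cut_gt0.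
  congr EFin; rewrite /betaf /mbetaf -powRrM mulrBr mulr1.
  rewrite (_ : l * u - 1 = l * u - l + (l - 1)); last by ring.
  rewrite (@powRD _ x (l * u - l)); first ring.
  by rewrite (gt_eqF x0) implybT.
- exact: itv_cut_gt0.
- exact: itv_cut_lt.
- by rewrite ltrBlDr ltrDl itv_cut_gt0.
- move=> x; rewrite !in_itv /= => x01; have /andP[x0 x1] := x01.
  by rewrite powR_gt0 // powR_lt1.
- move=> x y; rewrite !in_itv /= => /andP[x0 _] /andP[y0 _] xy.
  by rewrite gt0_ltr_powR // nnegrE ltW.
- move=> x; rewrite in_itv /= => /andP[x0 _].
  by apply: continuousM; [exact: cst_continuous|exact: continuous_powR].
- by move=> x; exact: continuous_betaf.
Unshelve. all: by end_near. Qed.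

(** Since x^m = x^(l (m/l)), the factor x^m is absorbed by moving u to u + m/l; moments thus become
    quotients of beta values. *)
Lemma mbetaf_moment u v l x (m : nat) : 0 < l -> x \in `]0, 1[ ->
  x ^+ m * mbetaf u v l x = mbetaf (u + m%:R / l) v l x.
Proof.
rewrite in_itv /= => l0 /andP[x0 x1]; rewrite /mbetaf -powR_mulrn ?ltW //.
have l_neq0 : l != 0 by rewrite gt_eqF.
have -> : l * (u + m%:R / l) - 1 = m%:R + (l * u - 1) by field.
rewrite (@powRD _ x m%:R); first ring.
by rewrite (gt_eqF x0) implybT.
Qed.

End modified_beta_integral.

(** * Mellin convolution of probability measures *)

Section concentrated.
Context d (T : measurableType d) (R : realType).
Local Open Scope ereal_scope.

Lemma ge0_integral_concentrated (mu : {measure set T -> \bar R}) (D : set T)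
    (f : T -> \bar R) : measurable D -> mu (~` D) = 0 ->
  measurable_fun setT f -> (forall x, 0 <= f x) ->
  \int[mu]_(x in D) f x = \int[mu]_x f x.
Proof.
move=> mD D0 mf f0; rewrite [RHS](ge0_negligible_integral (measurableC mD)) //.
by rewrite setTD setCK.
Qed.

Lemma measureI_concentrated (mu : {measure set T -> \bar R}) (D A : set T) :
  measurable D -> measurable A -> mu (~` D) = 0 -> mu (A `&` D) = mu A.
Proof.
move=> mD mA D0.
rewrite -integral_indic // ge0_integral_concentrated ?integral_indic ?setIT //.
by apply/measurable_EFinP; exact: measurable_indic.
Qed.

End concentrated.

Section mellin.
Context (R : realType).
Local Notation T := (measurableTypeR R).
Local Notation leb := (@lebesgue_measure R).
Local Open Scope ereal_scope.

(** y times the image of Lebesgue measure under x -> x y agrees with Lebesgue measure on the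
    intervals []a, b]], hence everywhere. *)
Lemma lebesgue_null_scale (y : R) (N : set T) : (0 < y)%R -> measurable N ->
  leb N = 0 -> leb [set x : T | N (x * y)%R] = 0.
Proof.
move=> y0 mN N0; pose f := fun x : T => (x * y)%R : T.
have mf : measurable_fun [set: T] f by exact: measurable_funM.
pose mu0 := mscale (NngNum (ltW y0)) (pushforward leb f).
pose mu := mu0 mf.
have muE : leb N = mu N.
  apply: (@lebesgue_measure_unique R mu) => // _ [[a b]] _ <-.
  transitivity (y%:E * leb (f @^-1` `]a, b]%classic)); last by [].
  rewrite (_ : f @^-1` _ = `](a / y)%R, (b / y)%R]%classic); last first.
    apply/seteqP; split => x /=; rewrite !in_itv /= /f.
      by rewrite ltr_pdivrMr // ler_pdivlMr.
    by rewrite ltr_pdivrMr // ler_pdivlMr.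
  rewrite !lebesgue_measure_itv /= !lte_fin ltr_pM2r ?invr_gt0 //.
  case: ifPn => _; last by rewrite mule0.
  by rewrite -!EFinB -EFinM; congr EFin; field; rewrite gt_eqF.
have : y%:E * leb (f @^-1` N) = 0 by rewrite -N0 muE.
by move/eqP; rewrite mule_eq0 eqe gt_eqF //= => /eqP.
Qed.

Lemma measurable_mulT : measurable_fun [set: T * T] (fun z : T * T => (z.2 * z.1)%R : T).
Proof. exact: measurable_funM. Qed.

Variables P1 P2 : probability T R.
Hypothesis P1_ge0 : P1 (~` `[0%R, +oo[) = 0.
Hypothesis P2_ge0 : P2 (~` `[0%R, +oo[) = 0.

Let mD : measurable (`[0%R, +oo[%classic : set T). Proof. by []. Qed.

Lemma measurable_dilation (A : set T) (y : R) : measurable A ->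
  measurable ([set x : T | A (x * y)%R] : set T).
Proof.
move=> mA; rewrite -[X in measurable X]setTI.
have mf : measurable_fun [set: T] (fun x : T => (x * y)%R : T) by exact: measurable_funM.
exact: mf.
Qed.

Lemma probability_dilation_xsection (A : set T) :
  (fun y : T => P1 [set x : T | A (x * y)%R]) =
  P1 \o xsection ((fun z : T * T => (z.2 * z.1)%R : T) @^-1` A).
Proof.
apply/funext => y /=; congr (P1 _); apply/seteqP.
by split => x; rewrite /xsection /= inE.
Qed.

Lemma measurable_fun_dilation (A : set T) : measurable A ->
  measurable_fun [set: T] (fun y : T => P1 [set x : T | A (x * y)%R]).
Proof.
move=> mA; rewrite probability_dilation_xsection.
apply: measurable_fun_xsection.
rewrite -[X in measurable X]setTI; exact: measurable_mulT.
Qed.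

Lemma mellin_convE (A : set T) : measurable A ->
  mellin_conv P1 P2 A = \int[P2]_y P1 [set x : T | A (x * y)%R].
Proof.
move=> mA; rewrite /mellin_conv.
transitivity (\int[P2]_(y in `[0%R, +oo[) P1 [set x : T | A (x * y)%R]).
  apply: eq_integral => y _.
  have mB := measurable_dilation y mA.
  transitivity (\int[P1]_(x in `[0%R, +oo[) (\1_[set x : T | A (x * y)%R] x)%:E).
    by apply: eq_integral => x _; congr EFin; rewrite !indicE.
  rewrite integral_indic //.
  exact: measureI_concentrated.
by rewrite ge0_integral_concentrated //; exact: measurable_fun_dilation.
Qed.

(** Q is the law of the product map under [P2 \x P1], with the variable of P2 first so that sections
    in it are the dilated sets. Absolute moments multiply by Tonelli. *)
Lemma mellin_probability : exists Q : probability T R,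
  [/\ forall A, measurable A -> Q A = \int[P2]_y P1 [set x : T | A (x * y)%R],
      forall A, measurable A -> mellin_conv P1 P2 A = Q A &
      forall m, \int[Q]_x (`|x| ^+ m)%:E =
        \int[P1]_x (`|x| ^+ m)%:E * \int[P2]_x (`|x| ^+ m)%:E].
Proof.
have [P21 P21E] : exists P : probability (T * T)%type R,
    P = (P2 \x P1) :> (set (T * T) -> \bar R).
  apply: mk_probability.
  exact: probability_setT.
pose X : {mfun (T * T)%type >-> T} := HB.pack (fun z : T * T => (z.2 * z.1)%R : T)
  (isMeasurableFun.Build _ _ _ _ _ measurable_mulT).
have QE (A : set T) : measurable A ->
    distribution P21 X A = \int[P2]_y P1 [set x : T | A (x * y)%R].
  move=> mA; rewrite /distribution /pushforward P21E /product_measure1.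
  by rewrite probability_dilation_xsection.
exists (distribution P21 X); split => [//|A mA|m].
  by rewrite mellin_convE //; exact/esym/QE.
have mpow : measurable_fun [set: T] (fun x : T => (`|x| ^+ m)%:E).
  apply/measurable_EFinP; apply: measurable_funX; exact: normr_measurable.
rewrite ge0_integral_distribution //.
rewrite P21E fubini_tonelli1 /fubini_F //=; first last.
  by apply: (measurableT_comp mpow); exact: measurable_mulT.
under eq_integral => y _.
  under eq_integral => x _ do rewrite normrM exprMn EFinM.
  rewrite ge0_integralZr //.
  over.
rewrite ge0_integralZl //.
by apply: integral_ge0 => x _; rewrite lee_fin exprn_ge0.
Qed.

End mellin.

(** * Determinacy of compactly supported moment sequences *)

Section step_polynomials.
Context (R : realType).
Implicit Types (c x y h t : R).

Lemma bernoulli_ineq x n : -1 <= x -> 1 + n%:R * x <= (1 + x) ^+ n.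
Proof.
move=> x1; elim: n => [|n IH]; first by rewrite mul0r addr0 expr0.
have x1' : 0 <= 1 + x by lra.
rewrite exprSr; apply: le_trans (ler_wpM2r x1' IH).
have := mulr_ge0 (ler0n R n) (sqr_ge0 x).
by rewrite -natr1; set N := n%:R; nra.
Qed.

(** With b the square root of c > 0, Bernoulli's inequality for 1/b bounds n b^n, and n c^n is that
    bounded sequence times b^n. *)
Lemma cvg_natmul_expr c : 0 <= c -> c < 1 -> (fun n => n%:R * c ^+ n) @ \oo --> (0 : R).
Proof.
move=> c0 c1; have [->|c_neq0] := eqVneq c 0.
  rewrite [X in X @ _](_ : _ = cst 0); first exact: cvg_cst.
  by apply/funext => -[|n] /=; rewrite ?mul0r // expr0n /= mulr0.
have cp : 0 < c by rewrite lt_neqAle eq_sym c_neq0.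
pose b := Num.sqrt c; have b0 : 0 < b by rewrite sqrtr_gt0.
have bE : c = b ^+ 2 by rewrite sqr_sqrtr.
have b1 : b < 1 by rewrite bE expr_lt1 ?ltW // in c1.
pose d := b^-1 - 1; have d0 : 0 < d by rewrite subr_gt0 invf_gt1.
have key n : n%:R * b ^+ n <= d^-1.
  have bn : 0 < b ^+ n by rewrite exprn_gt0.
  have : 1 + n%:R * d <= (1 + d) ^+ n by apply: bernoulli_ineq; lra.
  rewrite (_ : 1 + d = b^-1) ?exprVn => [H|]; last by rewrite /d addrC subrK.
  rewrite -[leRHS]mul1r ler_pdivlMr // mulrAC -ler_pdivlMr // mul1r.
  by apply: le_trans H; rewrite lerDr.
apply: (@squeeze_cvgr _ _ _ _ (cst 0) (fun n => d^-1 * b ^+ n)).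
- near=> n; have bn : 0 <= b ^+ n by rewrite exprn_ge0 // ltW.
  rewrite mulr_ge0 /= ?exprn_ge0 // bE exprAC expr2 mulrA.
  exact: ler_wpM2r.
- exact: cvg_cst.
- rewrite -[X in _ --> X](mulr0 d^-1); apply: cvgM; first exact: cvg_cst.
  by apply: cvg_expr; rewrite ger0_norm // ltW.
Unshelve. all: by end_near. Qed.

(* As a function of h on [0, 1], step n tends to the indicator of h < 1/2; the
   factor n in the exponent makes the limit 0 at h = 1/2 as well. *)
Definition step n h : R := (1 - h ^+ n) ^+ (n * 2 ^ n).

Lemma step_itv01 n h : 0 <= h -> h <= 1 -> 0 <= step n h <= 1.
Proof.
move=> h0 h1.
have hn0 : 0 <= h ^+ n by rewrite exprn_ge0.
have hn1 : h ^+ n <= 1 by rewrite exprn_ile1.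
by rewrite exprn_ge0 ?exprn_ile1 //; lra.
Qed.

Lemma natpow2E n h : (n * 2 ^ n)%:R * h ^+ n = n%:R * (2 * h) ^+ n.
Proof. by rewrite natrM natrX exprMn mulrA. Qed.

(** Bernoulli's inequality gives the lower bound 1 - n (2h)^n, with 2h < 1. *)
Lemma cvg_step_lt h : 0 <= h -> h < 2^-1 -> step ^~ h @ \oo --> (1 : R).
Proof.
move=> h0 h2.
apply: (@squeeze_cvgr _ _ _ _ (fun n => 1 - n%:R * (2 * h) ^+ n) (cst 1)).
- near=> n; have /andP[_ ->] := @step_itv01 n h h0 ltac:(lra); rewrite andbT.
  rewrite -natpow2E -mulrN; apply: bernoulli_ineq.
  by rewrite lerN2 exprn_ile1 //; lra.
- rewrite -[X in _ --> X]subr0; apply: cvgB; first exact: cvg_cst.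
  by apply: cvg_natmul_expr; lra.
- exact: cvg_cst.
Unshelve. all: by end_near. Qed.

(** With y = h^n and N = n 2^n, (1 - y)^N (1 + N y) <= (1 - y^2)^N <= 1, while N y = n (2h)^n >= n;
    hence the bound 1 / (n + 1). *)
Lemma cvg_step_ge h : 2^-1 <= h -> h <= 1 -> step ^~ h @ \oo --> (0 : R).
Proof.
move=> h2 h1.
apply: (@squeeze_cvgr _ _ _ _ (cst 0) (fun n => n.+1%:R^-1)); last exact: cvg_harmonic.
- near=> n; have /andP[-> _] := @step_itv01 n h ltac:(lra) h1; rewrite /=.
  set y := h ^+ n; set N := (n * 2 ^ n)%N.
  have y0 : 0 <= y by rewrite exprn_ge0 //; lra.
  have y1 : y <= 1 by rewrite exprn_ile1 //; lra.
  have Ny : n.+1%:R <= 1 + N%:R * y.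
    rewrite natpow2E -natr1 addrC lerD2l ler_peMr // exprn_ege1 //; lra.
  have p0 : 0 < 1 + N%:R * y by apply: lt_le_trans Ny.
  have sq : (1 - y) ^+ N * (1 + N%:R * y) <= 1.
    apply: (@le_trans _ _ ((1 - y) ^+ N * (1 + y) ^+ N)).
      by apply: ler_wpM2l; [rewrite exprn_ge0 //; lra|apply: bernoulli_ineq; lra].
    rewrite -exprMn exprn_ile1 //; nra.
  rewrite -ler_pdivlMr // mul1r in sq; apply: le_trans sq _.
  by rewrite lef_pV2 ?posrE.
- exact: cvg_cst.
Unshelve. all: by end_near. Qed.

End step_polynomials.

(** * Uniqueness of the law from its moments *)

Section moment_problem.
Context (R : realType).
Local Notation T := (measurableTypeR R).
Implicit Types (P : probability T R) (s : nat -> R).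
Local Open Scope ereal_scope.

Lemma has_moments_poly P s (q : {poly R}) : has_moments P s ->
  \int[P]_x (q.[x])%:E = (\sum_(i < size q) q`_i * s i)%:E.
Proof.
move=> Ps.
transitivity (\int[P]_x (\sum_(i < size q) (q`_i)%:E * (x ^+ i)%:E)).
  by apply: eq_integral => x _; rewrite horner_coef -sumEFin.
rewrite integral_sum //; last by move=> i; apply: integrableZl => //; have [] := Ps i.
rewrite -sumEFin; apply: eq_bigr => i _; have [iP EP] := Ps i.
by rewrite integralZl // EP.
Qed.

(** Markov's inequality for x^(2m): the mass outside [-2c, 2c] is at most (c / (2c))^(2m) = 4^(-m)
    for every m. *)
Lemma has_moments_concentrated P s (c : R) : (0 < c)%R -> has_moments P s ->
  (forall m, s (2 * m)%N <= c ^+ (2 * m))%R -> P (~` `[(- (2 * c))%R, (2 * c)%R]) = 0.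
Proof.
move=> c0 Ps sc; set D := ~` _.
have mD : measurable (D : set T) by exact: measurableC.
have H m : P D <= ((4^-1) ^+ m)%:E.
  have cm : (0 < (2 * c) ^+ (2 * m))%R by rewrite exprn_gt0 // mulr_gt0.
  have : ((2 * c) ^+ (2 * m))%:E * P D <= (c ^+ (2 * m))%:E.
    apply: (@le_trans _ _ (s (2 * m)%N)%:E); last by rewrite lee_fin.
    have [ix <-] := Ps (2 * m)%N.
    rewrite -integral_cst // integral_mkcond; apply: ge0_le_integral => //.
    - by move=> x _; rewrite patchE; case: ifPn => // _; rewrite lee_fin ltW.
    - by apply/(measurable_restrictT _ _).1.
    - by case/integrableP : ix.
    - move=> x _; rewrite patchE; case: ifPn => [|_]; last first.
        by rewrite lee_fin exprM exprn_ge0 // sqr_ge0.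
      rewrite inE /D /= in_itv /= => /negP; rewrite negb_and -!ltNge => xc.
      rewrite lee_fin !exprM lerXn2r ?nnegrE ?sqr_ge0 //.
      by case/orP: xc => xc; nra.
  rewrite -lee_pdivlMl // => /le_trans; apply.
  rewrite lee_fin exprMn invfM -mulrA mulVf ?gt_eqF ?exprn_gt0 // mulr1.
  by rewrite exprM -exprVn (_ : 2 ^+ 2 = 4)%R // expr2 -natrM.
apply/eqP; rewrite eq_le measure_ge0 andbT.
have c4 : ((4^-1) ^+ m)%:E @[m --> \oo] --> (0 : \bar R).
  apply: cvg_EFin; first by near=> n.
  by apply: cvg_expr; rewrite ger0_norm ?invf_lt1 ?invr_ge0 // ltr1n.
rewrite -(cvg_lim _ c4) //; apply: lime_ge; first by apply/cvg_ex; exists 0.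
by near=> n.
Unshelve. all: by end_near. Qed.

(** The integrals of the polynomials [q n] depend on the moments alone, and by dominated convergence
    they tend to the mass of the ray. *)
Lemma has_moments_ray P1 P2 s (M t : R) : has_moments P1 s -> has_moments P2 s ->
  (0 < M)%R -> P1 (~` `[(- M)%R, M]) = 0 -> P2 (~` `[(- M)%R, M]) = 0 ->
  P1 `]-oo, t[%classic = P2 `]-oo, t[%classic.
Proof.
move=> m1 m2 M0 P1M P2M.
(* L bounds |x - t| on [-M, M], so 1/2 + (x - t) / (2L) lies in [0, 1] there and is below 1/2
   exactly when x < t. *)
pose L : R := (M + `|t|)%R; have L0 : (0 < L)%R by rewrite ltr_wpDr.
pose h : {poly R} := ((2^-1)%:P + ((2 * L)^-1)%:P * ('X - t%:P))%R.
pose q n : {poly R} := ((1 - h ^+ n) ^+ (n * 2 ^ n))%R.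
have hE (x : R) : h.[x] = (2^-1 + (x - t) / (2 * L))%R.
  by rewrite /h !hornerE mulrC.
have qE n (x : R) : (q n).[x] = step n h.[x].
  by rewrite /q /step !(hornerE, horner_exp).
have lim P : has_moments P s -> P (~` `[(- M)%R, M]) = 0 ->
    (\sum_(i < size (q n)) (q n)`_i * s i)%:E @[n --> \oo] --> P `]-oo, t[%classic.
  move=> mP PM.
  have hM (x : R) : x \in `[(- M)%R, M] -> (0 <= h.[x] <= 1)%R.
    rewrite in_itv /= => /andP[x1 x2].
    have xt : (`|x - t| <= L)%R.
      by rewrite (le_trans (ler_normB _ _)) // lerD2r ler_norml x1.
    move: xt; rewrite ler_norml hE => /andP[? ?].
    have : (- 2^-1 <= (x - t) / (2 * L))%R.
      by rewrite ler_pdivlMr ?mulr_gt0 // mulNr mulrA mulVf ?pnatr_eq0 // mul1r.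
    have : ((x - t) / (2 * L) <= 2^-1)%R.
      by rewrite ler_pdivrMr ?mulr_gt0 // mulrA mulVf ?pnatr_eq0 // mul1r.
    by move=> *; apply/andP; split; lra.
  rewrite -(setIT `]-oo, t[%classic).
  rewrite -(integral_indic P measurableT) //.
  under eq_cvg do rewrite -(has_moments_poly _ mP).
  have [] := @dominated_convergence _ T R P setT measurableT
    (fun n x => ((q n).[x])%:E) (fun x => (\1_(`]-oo, t[%classic) x)%:E) (cst 1) => //.
  - move=> n; apply/measurable_EFinP; apply: continuous_measurable_fun.
    exact: continuous_horner.
  - by apply/measurable_EFinP; exact: measurable_indic.
  - exists (~` `[(- M)%R, M]); split => //; first exact: measurableC.
    apply: subsetC => x /= xM _; have /andP[h0 h1] := hM _ xM.
    under eq_cvg do rewrite qE.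
    apply: cvg_EFin; first by near=> n.
    rewrite indicE; have [xt|tx] := ltP x t.
      rewrite mem_set /= ?in_itv //; apply: cvg_step_lt => //.
      by rewrite hE gtrDl pmulr_llt0 ?invr_gt0 ?mulr_gt0 // subr_lt0.
    rewrite memNset /= ?in_itv /=; last by apply/negP; rewrite -leNgt.
    apply: cvg_step_ge => //.
    by rewrite hE lerDl divr_ge0 ?subr_ge0 // mulr_ge0 // ltW.
  - by apply: finite_measure_integrable_cst.
  exists (~` `[(- M)%R, M]); split => //; first exact: measurableC.
  apply: subsetC => x /= xM n _; have /andP[h0 h1] := hM _ xM.
  rewrite qE lee_fin; have /andP[s0 s1] := step_itv01 n h0 h1.
  by rewrite ger0_norm.
have /cvg_unique := lim P1 m1 P1M; apply => //; exact: lim.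
Unshelve. all: by end_near. Qed.

Lemma has_moments_unique P1 P2 s (M : R) : has_moments P1 s -> has_moments P2 s ->
  (0 < M)%R -> P1 (~` `[(- M)%R, M]) = 0 -> P2 (~` `[(- M)%R, M]) = 0 ->
  forall A, measurable A -> P1 A = P2 A.
Proof.
move=> m1 m2 M0 P1M P2M A mA.
apply: (@measure_unique _ R T (@RGenInftyO.G R) (fun n => `]-oo, n%:R[%classic)) => //.
- exact: RGenInftyO.measurableE.
- move=> _ _ [x ->] [y ->]; exists (Num.min x y).
  by apply/seteqP; split => z /=; rewrite !in_itv /= lt_min => /andP.
- by move=> n; exists n%:R.
- apply/seteqP; split => // x _; exists (Num.bound `|x|) => //=.
  by rewrite in_itv /= (le_lt_trans (ler_norm _)) // archi_boundP.
- by move=> _ [x ->]; exact: has_moments_ray P1M P2M.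
- by move=> n; rewrite (le_lt_trans (probability_le1 _ _)) ?ltry.
Qed.

End moment_problem.

(** * Iterated convolution of modified beta laws *)

Section modified_beta_probability.
Context (R : realType).
Local Notation T := (measurableTypeR R).
Local Notation leb := (@lebesgue_measure R).
Local Open Scope ereal_scope.

Lemma mbeta_probability (a u l : R) : (0 < u)%R -> (u < a)%R -> (0 < l)%R ->
  exists P : probability T R,
  [/\ forall A, measurable A -> mbeta a u l A = P A,
      P (~` `[0%R, 1%R]) = 0,
      forall N, measurable N -> leb N = 0 -> P N = 0,
      forall x y : R, (0 <= x)%R -> (x < y)%R -> (y <= 1)%R -> 0 < P `]x, y[%classic &
      forall m, \int[P]_x (`|x| ^+ m)%:E =
        (euler_beta (u + m%:R / l) (a - u) / euler_beta u (a - u))%:E].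
Proof.
move=> u0 ua l0; have v0 : (0 < a - u)%R by rewrite subr_gt0.
pose B := euler_beta u (a - u); have B0 : (0 < B)%R by exact: euler_beta_gt0.
pose g (x : R) : R := (B^-1 * mbetaf u (a - u) l x)%R.
have mg : measurable_fun [set: T] g.
  by apply: measurable_funM => //; exact: measurable_mbetaf.
have g0 x : (0 <= g x)%R by rewrite mulr_ge0 ?invr_ge0 ?mbetaf_ge0 // ltW.
(* A density measure integrates over the whole line, hence the truncation of [g] to [0, 1]. *)
pose f : T -> R := g \_ `[0%R, 1%R].
have mf : measurable_fun [set: T] f.
  by apply/(measurable_restrictT _ _).1 => //; exact: measurable_funS mg.
have f0 x : (0 <= f x)%R by rewrite /f patchE; case: ifPn.
have intf (A : set T) : \int[leb]_(x in A) (f x)%:E =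
    \int[leb]_(x in A `&` `[0%R, 1%R]) (g x)%:E.
  by rewrite integral_mkcondr; apply: eq_integral => x _; rewrite restrict_EFin.
have intg (m : nat) : \int[leb]_(x in `[0%R, 1%R]) ((`|x| ^+ m)%:E * (g x)%:E) =
    (euler_beta (u + m%:R / l) (a - u) / B)%:E.
  have mI (D : set T) : measurable_fun D (fun x : T => (`|x| ^+ m)%:E * (g x)%:E).
    apply: measurable_funTS; apply: emeasurable_funM; apply/measurable_EFinP => //.
    by apply: measurable_funX; exact: normr_measurable.
  rewrite integral_itv_bndoo; last exact: mI.
  transitivity (\int[leb]_(x in `]0%R, 1%R[) ((B^-1)%:E * (mbetaf (u + m%:R / l) (a - u) l x)%:E)).
    apply: eq_integral => x; rewrite inE /= => x01.
    rewrite -!EFinM -(mbetaf_moment _ _ _ l0 x01) ger0_norm.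
      by congr EFin; rewrite /g; ring.
    by move: x01; rewrite in_itv /= => /andP[/ltW].
  rewrite ge0_integralZl //; first last.
  - by rewrite lee_fin invr_ge0 ltW.
  - by move=> x _; rewrite lee_fin mbetaf_ge0 // ltW.
  - by apply/measurable_EFinP; apply: measurable_funTS; exact: measurable_mbetaf.
  rewrite integral_mbetaf // -euler_betaE //; last first.
    by rewrite ltr_wpDr // divr_ge0 // ltW.
  by rewrite -EFinM mulrC.
have [P PE] : exists P : probability T R, P = density_measure mf f0 :> (set T -> \bar R).
  (* The total mass is the moment of order 0. *)
  apply: mk_probability; apply: etrans (intf setT) _; rewrite setTI.
  have := intg 0%N; rewrite mul0r addr0 divff ?gt_eqF // => <-.
  by apply: eq_integral => x _; rewrite expr0 mul1e.
have PA A : P A = \int[leb]_(x in A `&` `[0%R, 1%R]) (g x)%:E.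
  by rewrite PE; exact: intf.
exists P; split.
- move=> A mA; rewrite PA /mbeta gt_eqF //.
  apply: eq_integral => x _; congr EFin; rewrite /g /mbetaf /B; ring.
- by rewrite PA setICl integral_set0.
- move=> N mN N0; rewrite PA (ge0_negligible_integral mN) //.
  + by rewrite setDE setIAC setICr set0I integral_set0.
  + exact: measurableI.
  + by apply/measurable_EFinP; exact: measurable_funTS.
  + by move=> x _; rewrite lee_fin.
- move=> x y x0 xy y1; rewrite PA.
  rewrite (_ : _ `&` _ = `]x, y[%classic); last first.
    apply/seteqP; split => z /=; rewrite !in_itv /=; first by case.
    by move=> /andP[xz zy]; split; apply/andP; split; lra.
  apply: integral_gt0_itv => // z; rewrite in_itv /= => /andP[xz zy].
  rewrite mulr_gt0 ?invr_gt0 // mbetaf_gt0 // in_itv /=.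
  by apply/andP; split; lra.
- move=> m; rewrite PE ge0_integral_density //; last first.
    by apply/measurable_EFinP; apply: measurable_funX; exact: normr_measurable.
  rewrite -intg [RHS]integral_mkcond; apply: eq_integral => x _.
  by rewrite /f !patchE; case: ifPn => // _; rewrite mule0.
Qed.

(** The fold works on bare set functions that are known to agree with probabilities on measurable
    sets only; this lets them be replaced there. *)
Lemma eq_mellin_conv (m1 m2 n1 n2 : set T -> \bar R) (A : set T) :
  (forall A, measurable A -> m1 A = n1 A) ->
  (forall A, measurable A -> m2 A = n2 A) ->
  mellin_conv m1 m2 A = mellin_conv n1 n2 A.
Proof.
move=> mn1 mn2; rewrite /mellin_conv (eq_integral_measurable _ _ mn2).
by congr integral; apply/funext => y; exact: eq_integral_measurable.
Qed.

End modified_beta_probability.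

Section mellin_fold.
Context (R : realType).
Local Notation T := (measurableTypeR R).
Local Notation leb := (@lebesgue_measure R).
Local Open Scope ereal_scope.

Lemma measure0_sub (P : {measure set T -> \bar R}) (A B : set T) :
  measurable A -> measurable B -> A `<=` B -> P B = 0 -> P A = 0.
Proof.
move=> mA mB AB B0; apply/eqP; rewrite eq_le measure_ge0 andbT -B0.
by rewrite le_measure ?inE.
Qed.

Lemma measure_gt0_sub (P : {measure set T -> \bar R}) (A B : set T) :
  measurable A -> measurable B -> A `<=` B -> 0 < P A -> 0 < P B.
Proof. by move=> mA mB AB /lt_le_trans; apply; rewrite le_measure ?inE. Qed.

Lemma concentrated_ge0 (P : {measure set T -> \bar R}) (c : R) :
  P (~` `[0%R, c]) = 0 -> P (~` `[0%R, +oo[) = 0.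
Proof.
apply: measure0_sub; try exact: measurableC.
by apply: subsetC => x /=; rewrite !in_itv /= => /andP[->].
Qed.

Lemma mbeta_eq (u l : R) : mbeta u u l = \d_(1%R : R) :> (set T -> \bar R).
Proof. by rewrite /mbeta eqxx. Qed.

Lemma mellin_conv1 (P : probability T R) (A : set T) :
  P (~` `[0%R, +oo[) = 0 -> measurable A -> mellin_conv (\d_(1%R : R)) P A = P A.
Proof.
move=> P0 mA.
have D0 : (\d_(1%R : T) : probability T R) (~` `[0%R, +oo[) = 0.
  by rewrite /= diracE memNset //=; apply; rewrite in_itv /= ler01.
rewrite (mellin_convE D0 P0 mA) /=.
transitivity (\int[P]_y (\1_A y)%:E); last by rewrite integral_indic ?setIT.
apply: eq_integral => y _; rewrite diracE indicE.
suff -> : ((1%R : T) \in [set x : T | A (x * y)%R]) = (y \in A) by [].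
by apply/idP/idP; rewrite !inE /= mul1r.
Qed.

(* The atom-free and top-of-support clauses hold without any strict beta factor; they
   are what makes the last clause propagate through the convolution. *)
Lemma mellin_fold (l c : R) (js : seq (R * R)) : (0 < l)%R -> (0 < c)%R ->
  (forall p, p \in js -> (0 < p.2)%R /\ (p.2 <= p.1)%R) ->
  exists P : probability T R,
  [/\ forall A, measurable A ->
        foldr (@mellin_conv R) (\d_(c : R)) [seq mbeta p.1 p.2 l | p <- js] A = P A,
      [/\ P (~` `[0%R, c]) = 0, P [set 0%R] = 0 &
        forall a : R, (0 <= a)%R -> (a < c)%R -> 0 < P `]a, c]%classic],
      forall m : nat, exists2 w : R, \int[P]_x (`|x| ^+ m)%:E = (c ^+ m * w)%:E &
        (fun n => (\prod_(p <- js) (poch_ratio (m%:R / l) n p.1 / poch_ratio (m%:R / l) n p.2))%R)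
          @ \oo --> w &
      has (fun p => p.2 < p.1)%R js ->
        (forall N, measurable N -> leb N = 0 -> P N = 0) /\
        forall a b : R, (0 <= a)%R -> (a < b)%R -> (b <= c)%R -> 0 < P `]a, b[%classic].
Proof.
move=> l0 c0; elim: js => [_|[a u] js IH js0].
  exists (\d_(c : T) : probability T R); split => //.
  - split.
    + by rewrite /= diracE memNset //=; apply; rewrite in_itv /= lexx ltW.
    + by rewrite /= diracE memNset //= => c_eq0; move: c0; rewrite c_eq0 ltxx.
    + by move=> x x0 xc; rewrite /= diracE mem_set /= ?lte01 // in_itv /= xc lexx.
  - move=> m; exists 1%R.
      rewrite integral_dirac //.
        by rewrite diracT mul1e mulr1 gtr0_norm.
      by apply/measurable_EFinP; apply: measurable_funX; exact: normr_measurable.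
    by under eq_cvg do rewrite big_nil; exact: cvg_cst.
have [|P [PE [Pc P0 Ptop] Pm Pac]] := IH.
  by move=> p pjs; apply: js0; rewrite inE pjs orbT.
have Pge0 := concentrated_ge0 Pc.
have [/= u0 ua] := js0 (a, u) (mem_head _ _).
have [ltua|] := boolP (u < a)%R; last first.
  (* A degenerate factor is the unit mass at 1, neutral for the convolution; its ratio of products
     is 1. *)
  rewrite -leNgt => au; have {au ua}-> : a = u by apply/eqP; rewrite eq_le au ua.
  exists P; split => //.
  - move=> A mA /=; rewrite mbeta_eq.
    by rewrite (eq_mellin_conv A (n1 := \d_(1%R : R)) (n2 := P)) // mellin_conv1.
  - move=> m; have [w wE cw] := Pm m; exists w => //.
    apply: cvg_trans cw; apply: near_eq_cvg; near=> n; rewrite big_cons divff ?mul1r //=.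
    by rewrite gt_eqF // poch_ratio_gt0 // divr_ge0 // ltW.
have [P1 [P1E P1c P1null P1pos P1m]] := mbeta_probability u0 ltua l0.
have [Q [QE QM Qm]] := mellin_probability (concentrated_ge0 P1c) Pge0.
have leb0 : leb [set 0%R : T] = 0 by exact: lebesgue_measure_set1.
have mset0 : measurable ([set 0%R] : set T) by exact: measurable_set1.
(* [N0] is the complement of ]0, c]. It is P-null because P has no atom at 0, so only dilations by y
   in ]0, c] count in the integral defining Q. *)
pose N0 : set T := ~` `[0%R, c] `|` [set 0%R].
have mN0 : measurable N0 by apply: measurableU => //; exact: measurableC.
have PN0 : P N0 = 0.
  apply/eqP; rewrite eq_le measure_ge0 andbT.
  apply: le_trans (measureU2 _ _ _) _ => //; first exact: measurableC.
  by rewrite [X in X + _]Pc [X in _ + X]P0 adde0.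
have N0P y : ~ N0 y -> (0 < y)%R && (y <= c)%R.
  move=> yN; have yc : y \in `[0%R, c].
    by apply: contrapT => yc; apply: yN; left.
  move: yc; rewrite in_itv /= => /andP[y0 ->]; rewrite andbT lt_neqAle y0 andbT.
  by apply/eqP => y_eq0; apply: yN; right.
have Qnull N : measurable N -> (forall y : R, (0 < y)%R -> (y <= c)%R ->
    P1 [set x : T | N (x * y)%R] = 0) -> Q N = 0.
  move=> mN H; rewrite QE //; apply: (integral_null mN0) => //.
    exact: measurable_fun_dilation.
  by move=> y /N0P /andP[y0 yc]; exact: H.
(* For z in ]x, c] the dilated interval contains ]x/z, min(y/z, 1)[, a nonempty open subinterval of
   [0, 1] charged by the beta law; and P charges ]x, c]. *)
have Qpos (x y : R) : (0 <= x)%R -> (x < y)%R -> (y <= c)%R -> 0 < Q `]x, y[%classic.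
  move=> x0 xy yc; rewrite QE //.
  apply: (@integral_gt0 _ T R P `]x, c]%classic) => //.
  - exact: measurable_fun_dilation.
  - move=> z /=; rewrite in_itv /= => /andP[xz zc].
    have z0 : (0 < z)%R by apply: le_lt_trans xz.
    apply: (@measure_gt0_sub _ `](x / z)%R, (Num.min (y / z) 1)%R[%classic) => //.
    + exact: (measurable_dilation z (measurable_itv `]x, y[)).
    + move=> t /=; rewrite !in_itv /= lt_min ltr_pdivrMr // ltr_pdivlMr //.
      by move=> /andP[-> /andP[-> _]].
    + apply: P1pos; first by rewrite divr_ge0 // ltW.
        by rewrite lt_min ltr_pM2r ?invr_gt0 // xy ltr_pdivrMr // mul1r.
      by rewrite ge_min lexx orbT.
  - by apply: Ptop => //; exact: lt_le_trans yc.
exists Q; split.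
- by move=> A mA /=; rewrite (eq_mellin_conv A P1E PE) QM.
- split.
  + apply: Qnull => [|y y0 yc]; first exact: measurableC.
    apply: measure0_sub P1c; [|exact: measurableC|].
      by apply: (measurable_dilation y); exact: measurableC.
    apply: subsetC => x /=; rewrite !in_itv /= => /andP[x0 x1].
    rewrite mulr_ge0 // ?(ltW y0) //=.
    by apply: le_trans yc; rewrite ler_piMl // ltW.
  + apply: Qnull => // y y0 _; apply: P1null; first exact: (measurable_dilation y).
    exact: lebesgue_null_scale.
  + move=> x x0 xc; apply: (@measure_gt0_sub _ `]x, c[%classic) => //.
      by move=> z /=; rewrite !in_itv /= => /andP[-> /ltW].
    exact: Qpos.
- move=> m; have [w wE cw] := Pm m.
  exists (euler_beta (u + m%:R / l) (a - u) / euler_beta u (a - u) * w)%R.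
    by rewrite Qm P1m wE -EFinM; congr EFin; ring.
  under eq_cvg do rewrite big_cons /=.
  apply: cvgM => //.
  have := @cvg_euler_beta_ratio R u (a - u) (m%:R / l).
  rewrite (_ : u + (a - u) = a)%R; last by rewrite addrC subrK.
  by apply; rewrite ?subr_gt0 // divr_ge0 // ltW.
- move=> _; split => // N mN leb_N; apply: Qnull => // y y0 _.
  apply: P1null; first exact: (measurable_dilation y).
  exact: lebesgue_null_scale.
Unshelve. all: by end_near. Qed.

End mellin_fold.

(** * Moments and support of a law carried by [0, c] *)

Section bounded_support.
Context (R : realType).
Local Notation T := (measurableTypeR R).
Local Open Scope ereal_scope.

Lemma has_moments_itv0 (P : probability T R) (c : R) (s : nat -> R) :
  P (~` `[0%R, c]) = 0 ->
  (forall m, \int[P]_x (`|x| ^+ m)%:E = (s m)%:E) -> has_moments P s.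
Proof.
move=> Pc Ps m.
have mX : measurable_fun [set: T] (fun x : T => (x ^+ m)%:E).
  by apply/measurable_EFinP; exact: measurable_funX.
have mN : measurable_fun [set: T] (fun x : T => (`|x| ^+ m)%:E).
  by apply/measurable_EFinP; apply: measurable_funX; exact: normr_measurable.
split.
  apply/integrableP; split => //.
  under eq_integral do rewrite /= normrX.
  by rewrite Ps ltry.
rewrite -Ps; apply: ae_eq_integral => //.
exists (~` `[0%R, c]); split => //; first exact: measurableC.
apply: subsetC => x /=; rewrite in_itv /= => /andP[x0 _] _.
by rewrite ger0_norm.
Qed.

Lemma moment_itv0_le (P : probability T R) (c : R) (m : nat) : (0 < c)%R ->
  P (~` `[0%R, c]) = 0 -> \int[P]_x (`|x| ^+ m)%:E <= (c ^+ m)%:E.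
Proof.
move=> c0 Pc.
have mN : measurable_fun [set: T] (fun x : T => (`|x| ^+ m)%:E).
  by apply/measurable_EFinP; apply: measurable_funX; exact: normr_measurable.
rewrite -(@ge0_integral_concentrated _ T R P `[0%R, c]%classic) //.
apply: (@le_trans _ _ (\int[P]_(x in `[0%R, c]) (c ^+ m)%:E)).
  apply: ge0_le_integral => //.
  - exact: measurable_funTS.
  - move=> x /=; rewrite in_itv /= => /andP[x0 xc].
    by rewrite lee_fin ger0_norm // lerXn2r // nnegrE ltW.
rewrite integral_cst // -[leRHS]mule1; apply: lee_wpmul2l.
  by rewrite lee_fin exprn_ge0 // ltW.
exact: probability_le1.
Qed.

Lemma msupport_itv (P : probability T R) (c : R) : (0 < c)%R ->
  P (~` `[0%R, c]) = 0 ->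
  (forall a b : R, (0 <= a)%R -> (a < b)%R -> (b <= c)%R -> 0 < P `]a, b[%classic) ->
  msupport P = `[0%R, c]%classic.
Proof.
move=> c0 Pc Ppos; apply/seteqP; split => x.
  move=> xS; apply: contrapT => xc.
  have oC : open (~` `[0%R, c] : set R) by exact/closed_openC/itv_closed.
  by have := xS _ oC xc; rewrite Pc ltxx.
rewrite /= in_itv /= => /andP[x0 xc] U oU Ux.
have [e /= e0 eU] : exists2 e : R, (0 < e)%R & `](x - e)%R, (x + e)%R[ `<=` U.
  have /nbhs_ballP[e /= e0 eU] := open_nbhs_nbhs (conj oU Ux).
  exists e => // y /=; rewrite in_itv /= => /andP[y1 y2]; apply: eU.
  by rewrite /ball /= ltr_norml; apply/andP; split; lra.
(* Clipping to [0, c] leaves a nonempty open interval inside U, even when x is 0 or c. *)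
pose a := Num.max 0%R (x - e)%R; pose b := Num.min c (x + e)%R.
have ab : (a < b)%R.
  by rewrite gt_max !lt_min c0 /=; apply/andP; split; [|apply/andP; split]; lra.
apply: lt_le_trans (Ppos a b _ ab _) _.
- by rewrite le_max lexx.
- by rewrite ge_min lexx.
rewrite le_measure ?inE //; first exact: open_measurable.
move=> y /=; rewrite in_itv /= gt_max lt_min => /andP[/andP[_ y1] /andP[_ y2]].
by apply: eU; rewrite /= in_itv /= y1.
Qed.

End bounded_support.

(** * Identification of the moments and properties of the law *)

Theorem theorem3p3 (R : realType) (k l : nat) (p r : R)
    (hl : (1 <= l)%N) (hlk : (l < k)%N) (hp : p = k%:R / l%:R)
    (hr1 : -1 < r) (hr2 : r <= p - 1) :
  exists nu : probability (measurableTypeR R) R,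
    [/\ has_moments nu (fun m => gbinom (m%:R * p + r) m),
        (forall nu' : probability (measurableTypeR R) R,
           has_moments nu' (fun m => gbinom (m%:R * p + r) m) ->
           forall A : set (measurableTypeR R), measurable A -> nu' A = nu A),
        (forall A : set (measurableTypeR R), measurable A ->
           nu A = mellin_beta k l r (cp p) A),
        nu `<< lebesgue_measure
      & msupport nu = `[0, cp p]%classic].
Proof.
have l0R : 0 < l%:R :> R by rewrite ltr0n.
have kR : l%:R < k%:R :> R by rewrite ltr_nat.
have p1 : 1 < p by rewrite hp ltr_pdivlMr // mul1r.
have rk : r <= k%:R / l%:R - 1 by rewrite -hp.
pose c := cp p; have c0 : 0 < c by rewrite mulr_gt0 // powR_gt0 //; lra.
pose js := [seq (talpha k l r j, beta_ k r j) | j <- iota 1 k].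
have js0 q : q \in js -> 0 < q.2 /\ q.2 <= q.1.
  move=> /mapP[j]; rewrite mem_iota => /andP[j1 jk] -> /=; split.
    have : 1 <= j%:R :> R by rewrite ler1n.
    by move=> ?; rewrite divr_gt0 //; lra.
  by apply: beta_le_talpha => //; lia.
have [P [PE [Pc _ _] Pm Pac]] := mellin_fold l0R c0 js0.
(* The existence of a strict beta factor, due to l < k, unlocks the last clause of [mellin_fold]. *)
have [Pnull Ppos] : (forall N, measurable N -> lebesgue_measure N = 0%E -> P N = 0%E) /\
    forall a b : R, 0 <= a -> a < b -> b <= c -> (0 < P `]a, b[%classic)%E.
  apply: Pac; have [j jk jlt] := beta_lt_talpha hl hlk hr1 rk.
  apply/hasP; exists (talpha k l r j, beta_ k r j) => //.
  by apply/mapP; exists j => //; rewrite mem_iota; lia.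
have Pmom m : (\int[P]_x (`|x| ^+ m)%:E = (gbinom (m%:R * p + r) m)%:E)%E.
  have [w -> cw] := Pm m; congr EFin.
  have cg := cvg_gbinom (m := m) hl hlk hp hr1.
  (* Both are limits of the same sequence, once [talpha_prod] with F the n-truncated [poch_ratio]
     regroups the numerators. *)
  have -> : w = gbinom (m%:R * p + r) m / cp p ^+ m.
    apply: cvg_unique cw _ => //; apply: cvg_trans cg; apply: near_eq_cvg; near=> n.
    rewrite big_map prodf_div /=.
    have iotaE (F : nat -> R) : \prod_(j <- iota 1 k) F j = \prod_(j < k) F j.+1.
      by rewrite -(big_mkord xpredT (fun j => F j.+1))
        -(big_add1 _ _ 0 k.+1 xpredT F) /index_iota subn1.
    by rewrite !iotaE /= (talpha_prod hl hlk hr1 rk (poch_ratio (m%:R / l%:R) n)).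
  by rewrite mulrC divfK // expf_neq0 // gt_eqF.
have Phas : has_moments P (fun m => gbinom (m%:R * p + r) m).
  exact: has_moments_itv0 Pc Pmom.
(* The growth bound is read off P itself; it then confines any law with these moments to
   [-2c, 2c]. *)
have bound m : gbinom ((2 * m)%N%:R * p + r) (2 * m) <= c ^+ (2 * m).
  by rewrite -lee_fin -Pmom; exact: moment_itv0_le.
exists P; split => //.
- move=> nu' nu'm A mA.
  apply: (has_moments_unique (M := 2 * c) nu'm Phas) => //.
  + by rewrite mulr_gt0.
  + exact: has_moments_concentrated nu'm bound.
  + exact: has_moments_concentrated Phas bound.
- move=> A mA; rewrite -PE // /mellin_beta /js -map_comp.
  by congr (foldr _ _ _ A).
- move=> N nullN A mA AN; apply: Pnull => //; exact: nullN.
- exact: msupport_itv.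
Unshelve. all: by end_near. Qed.
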